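(* Let $R=D(\sigma,a)$ be a quantum generalized Weyl algebra with parameter $q$, where $D=\Bbbk[h]$ or $D=\Bbbk[h^{\pm1}]$ and $a(h)=(h-c_1)(h-c_2)\cdots(h-c_{N_a})$. Let $\gamma,\mu\in\Bbbk^\times$ with $\mathrm{ord}(\gamma)=n<\infty$, $\mathrm{ord}(\mu)=m<\infty$, $n\mid i_0$ and $\gcd(n,m)=1$, and let $\eta=\eta_{\gamma,\mu}\in\mathrm{Aut}(R)$. If $\eta$ is not the identity, then $R^{\langle\eta\rangle}\not\cong R$.
   Context: $\Bbbk$ is a field and all algebras are associative $\Bbbk$-algebras; isomorphism means isomorphism of $\Bbbk$-algebras. For a commutative algebra $D$, $\sigma\in\mathrm{Aut}(D)$ and $0\neq a\in D$, the generalized Weyl algebra (GWA) $D(\sigma,a)$ is generated over $D$ by $x,y$ subject to $xd=\sigma(d)x$, $yd=\sigma^{-1}(d)y$ ($d\in D$), $yx=a$, $xy=\sigma(a)$. It is quantum if $D=\Bbbk[h]$ or $D=\Bbbk[h^{\pm1}]$ and $\sigma(h)=qh$ with $q\in\Bbbk\setminus\{0,1\}$. The polynomial $a(h)$ is monic of positive degree, splits into linear factors over $\Bbbk$, and $N_a$ is its number of roots counted with multiplicity. $0$ is allowed as a root of $a$ only when $D=\Bbbk[h]$. Write $a=\sum_{i\in I}a_ih^i$ with $I$ the set of $i$ with $a_i\neq0$, and $g=\gcd\{i-j: a_ia_j\neq0\}$. If $a$ is a monomial put $C_g=\Bbbk^\times$; otherwise $C_g$ is the group of $g$th roots of unity in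 $\Bbbk$. Fix $i_0\in I$. For $\gamma\in C_g$ and $\mu\in\Bbbk^\times$, $\eta_{\gamma,\mu}$ is the automorphism of $R$ with $\eta_{\gamma,\mu}(h)=\gamma h$, $\eta_{\gamma,\mu}(y)=y\mu$, $\eta_{\gamma,\mu}(x)=\mu^{-1}\gamma^{i_0}x$ (independent of the choice of $i_0$); writing $\eta_{\gamma,\mu}$ presupposes $\gamma\in C_g$. $\mathrm{ord}$ denotes multiplicative order in $\Bbbk^\times$, and $R^{\langle\eta\rangle}$ is the subring of elements fixed by $\eta$. *)

(* Defs.v *)
From HB Require Import structures.
From mathcomp Require Import all_boot all_order all_algebra.
From mathcomp Require Import boolp.

Set Implicit Arguments.
Unset Strict Implicit.
Unset Printing Implicit Defensive.

Import GRing.Theory.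
Local Open Scope ring_scope.
Local Open Scope quotient_scope.

Record algAut (k : fieldType) (A : algType k) := AlgAut {
  aut_mor :> {lrmorphism A -> A};
  aut_inv : A -> A;
  autK : cancel aut_mor aut_inv;
  autVK : cancel aut_inv aut_mor }.

Definition alg_isomorphic (k : fieldType) (A B : algType k) : Prop :=
  exists f : {lrmorphism A -> B}, bijective f.

Section FixedAlgebra.
Variables (k : fieldType) (A : algType k) (eta : algAut A).

Definition fixed_pred : {pred A} := fun r => eta r == r.

Fact fixed_subalg_closed : subalg_closed fixed_pred.
Proof.
split=> [|c u v|u v]; rewrite !unfold_in ?rmorph1 //.
- by move=> /eqP eu /eqP ev; rewrite linearP /= eu ev.
- by move=> /eqP eu /eqP ev; rewrite rmorphM /= eu ev.
Qed.

HB.instance Definition _ :=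
  GRing.isSubringClosed.Build A fixed_pred
    (GRing.subalg_closedBM fixed_subalg_closed).
HB.instance Definition _ :=
  GRing.isScaleClosed.Build k A fixed_pred
    (GRing.subalg_closedZ fixed_subalg_closed).

Record fixed_alg := FixedAlg {
  fixed_val :> A;
  _ : fixed_val \in fixed_pred }.

HB.instance Definition _ := [isSub for fixed_val].
HB.instance Definition _ := [Choice of fixed_alg by <:].
HB.instance Definition _ := [SubChoice_isSubAlgebra of fixed_alg by <:].

End FixedAlgebra.

(* Laurent polynomials k[h^{+-1}], realised inside the field of fractions of  *)
(* k[h] as the fractions of the form p / h^n.                                 *)

Section Laurent.
Variable k : fieldType.

Definition laurent_pred : {pred {fraction {poly k}}} :=
  fun f => `[< exists (p : {poly k}) (n : nat),
                 f = FracField.tofrac p / FracField.tofrac 'X ^+ n >].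

Let X_neq0 n : FracField.tofrac ('X : {poly k}) ^+ n != 0.
Proof. by rewrite expf_neq0 // tofrac_eq0 polyX_eq0. Qed.

Fact laurent_subring_closed : subring_closed laurent_pred.
Proof.
split=> [|u v|u v]; rewrite ?unfold_in.
- by apply/asboolP; exists 1, 0; rewrite tofrac1 divr1.
- move=> /asboolP[p [n ->]] /asboolP[r [m ->]]; apply/asboolP.
  exists (p * 'X^m - r * 'X^n), (n + m)%N.
  by rewrite tofracB !tofracM !tofracXn -mulNr addf_div ?X_neq0 // mulNr exprD.
- move=> /asboolP[p [n ->]] /asboolP[r [m ->]]; apply/asboolP.
  by exists (p * r), (n + m)%N; rewrite mulf_div tofracM exprD.
Qed.

HB.instance Definition _ :=
  GRing.isSubringClosed.Build {fraction {poly k}} laurent_pred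
    laurent_subring_closed.

Record laurent := Laurent {
  laurent_val :> {fraction {poly k}};
  _ : laurent_val \in laurent_pred }.

HB.instance Definition _ := [isSub for laurent_val].
HB.instance Definition _ := [Choice of laurent by <:].
HB.instance Definition _ := [SubChoice_isSubComNzRing of laurent by <:].

Fact laurent_of_poly_subproof (p : {poly k}) :
  FracField.tofrac p \in laurent_pred.
Proof. by apply/asboolP; exists p, 0; rewrite divr1. Qed.

Definition laurent_of_poly (p : {poly k}) : laurent :=
  Laurent (laurent_of_poly_subproof p).

Definition laurent_scale (c : k) (f : laurent) : laurent :=
  laurent_of_poly c%:P * f.

Fact laurent_scaleA c d f :
  laurent_scale c (laurent_scale d f) = laurent_scale (c * d) f.
Proof. by apply: val_inj; rewrite /= polyCM tofracM mulrA. Qed.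
Fact laurent_scale1 : left_id 1 laurent_scale.
Proof. by move=> f; apply: val_inj; rewrite /= polyC1 tofrac1 mul1r. Qed.
Fact laurent_scaleDr : right_distributive laurent_scale +%R.
Proof. by move=> c f g; apply: val_inj; rewrite /= mulrDr. Qed.
Fact laurent_scaleDl f :
  {morph laurent_scale^~ f : c d / c + d}.
Proof. by move=> c d; apply: val_inj; rewrite /= polyCD tofracD mulrDl. Qed.

HB.instance Definition _ :=
  GRing.Zmodule_isLmodule.Build k laurent
    laurent_scaleA laurent_scale1 laurent_scaleDr laurent_scaleDl.

Fact laurent_scaleAl (c : k) (f g : laurent) : c *: (f * g) = c *: f * g.
Proof. by apply: val_inj; rewrite /= mulrA. Qed.

HB.instance Definition _ :=
  GRing.Lmodule_isLalgebra.Build k laurent laurent_scaleAl.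
HB.instance Definition _ := GRing.Lalgebra_isComAlgebra.Build k laurent.

End Laurent.

(* The generalized Weyl algebra D(sigma, a), as the quotient of the algebra   *)
(* of noncommutative expressions in the elements of D and two letters x, y    *)
(* by the congruence generated by the ring axioms, the ring structure of D    *)
(* and the defining relations.                                                *)

Section GWA.
Variables (k : fieldType) (D : comAlgType k) (sigma : algAut D) (a : D).

Inductive gwa_term :=
| TBase of D
| TX
| TY
| TAdd of gwa_term & gwa_term
| TOpp of gwa_term
| TMul of gwa_term & gwa_term.

Inductive gwa_cong : gwa_term -> gwa_term -> Prop :=
| Crefl t : gwa_cong t t
| Csym t u : gwa_cong t u -> gwa_cong u t
| Ctrans t u v : gwa_cong t u -> gwa_cong u v -> gwa_cong t v
| Cadd t t' u u' :
    gwa_cong t t' -> gwa_cong u u' -> gwa_cong (TAdd t u) (TAdd t' u')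
| Copp t t' : gwa_cong t t' -> gwa_cong (TOpp t) (TOpp t')
| Cmul t t' u u' :
    gwa_cong t t' -> gwa_cong u u' -> gwa_cong (TMul t u) (TMul t' u')
| CaddA t u v : gwa_cong (TAdd t (TAdd u v)) (TAdd (TAdd t u) v)
| CaddC t u : gwa_cong (TAdd t u) (TAdd u t)
| Cadd0 t : gwa_cong (TAdd (TBase 0) t) t
| CaddN t : gwa_cong (TAdd (TOpp t) t) (TBase 0)
| CmulA t u v : gwa_cong (TMul t (TMul u v)) (TMul (TMul t u) v)
| Cmul1l t : gwa_cong (TMul (TBase 1) t) t
| Cmul1r t : gwa_cong (TMul t (TBase 1)) t
| CmulDl t u v : gwa_cong (TMul (TAdd t u) v) (TAdd (TMul t v) (TMul u v))
| CmulDr t u v : gwa_cong (TMul t (TAdd u v)) (TAdd (TMul t u) (TMul t v))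
| CbaseD d e : gwa_cong (TBase (d + e)) (TAdd (TBase d) (TBase e))
| CbaseM d e : gwa_cong (TBase (d * e)) (TMul (TBase d) (TBase e))
| CrelX d : gwa_cong (TMul TX (TBase d)) (TMul (TBase (sigma d)) TX)
| CrelY d : gwa_cong (TMul TY (TBase d)) (TMul (TBase (aut_inv sigma d)) TY)
| CrelYX : gwa_cong (TMul TY TX) (TBase a)
| CrelXY : gwa_cong (TMul TX TY) (TBase (sigma a)).

HB.instance Definition _ := gen_eqMixin gwa_term.
HB.instance Definition _ := gen_choiceMixin gwa_term.

Definition gwa_congb : rel gwa_term := fun t u => `[< gwa_cong t u >].

Fact gwa_congb_refl : reflexive gwa_congb.
Proof. by move=> t; apply/asboolP; apply: Crefl. Qed.
Fact gwa_congb_sym : symmetric gwa_congb.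
Proof. by move=> t u; apply/asboolP/asboolP; apply: Csym. Qed.
Fact gwa_congb_trans : transitive gwa_congb.
Proof.
by move=> u t v /asboolP tu /asboolP uv; apply/asboolP; apply: Ctrans tu uv.
Qed.

Canonical gwa_congb_equiv :=
  EquivRel gwa_congb gwa_congb_refl gwa_congb_sym gwa_congb_trans.

Definition gwa := {eq_quot gwa_congb}.
HB.instance Definition _ := Choice.on gwa.
HB.instance Definition _ : EqQuotient _ gwa_congb gwa := EqQuotient.on gwa.

Lemma gwa_piP t u : reflect (\pi_gwa t = \pi_gwa u) `[< gwa_cong t u >].
Proof. exact: (@eqquotP _ gwa_congb gwa). Qed.

Lemma gwa_pi_eq t u : gwa_cong t u -> \pi_gwa t = \pi_gwa u.
Proof. by move=> tu; apply/gwa_piP/asboolP. Qed.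

Lemma gwa_pi_cong t u : \pi_gwa t = \pi_gwa u -> gwa_cong t u.
Proof. by move/gwa_piP/asboolP. Qed.

Lemma gwa_cong_repr t : gwa_cong (repr (\pi_gwa t)) t.
Proof. by apply: gwa_pi_cong; rewrite reprK. Qed.

Definition gwa_base (d : D) : gwa := \pi_gwa (TBase d).
Definition gwa_x : gwa := \pi_gwa TX.
Definition gwa_y : gwa := \pi_gwa TY.
Definition gwa_add (u v : gwa) : gwa := \pi_gwa (TAdd (repr u) (repr v)).
Definition gwa_opp (u : gwa) : gwa := \pi_gwa (TOpp (repr u)).
Definition gwa_mul (u v : gwa) : gwa := \pi_gwa (TMul (repr u) (repr v)).

Lemma gwa_pi_add t u : \pi_gwa (TAdd t u) = gwa_add (\pi_gwa t) (\pi_gwa u).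
Proof. by apply/gwa_pi_eq/Cadd; apply/Csym/gwa_cong_repr. Qed.
Lemma gwa_pi_opp t : \pi_gwa (TOpp t) = gwa_opp (\pi_gwa t).
Proof. by apply/gwa_pi_eq/Copp; apply/Csym/gwa_cong_repr. Qed.
Lemma gwa_pi_mul t u : \pi_gwa (TMul t u) = gwa_mul (\pi_gwa t) (\pi_gwa u).
Proof. by apply/gwa_pi_eq/Cmul; apply/Csym/gwa_cong_repr. Qed.

Let gwa_ind (P : gwa -> Prop) : (forall t, P (\pi_gwa t)) -> forall u, P u.
Proof. by move=> Pt u; rewrite -[u]reprK. Qed.

Fact gwa_addA : associative gwa_add.
Proof.
elim/gwa_ind=> t; elim/gwa_ind=> u; elim/gwa_ind=> v.
by rewrite -!gwa_pi_add; apply/gwa_pi_eq/CaddA.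
Qed.
Fact gwa_addC : commutative gwa_add.
Proof.
elim/gwa_ind=> t; elim/gwa_ind=> u.
by rewrite -!gwa_pi_add; apply/gwa_pi_eq/CaddC.
Qed.
Fact gwa_add0 : left_id (gwa_base 0) gwa_add.
Proof.
by elim/gwa_ind=> t; rewrite /gwa_base -gwa_pi_add; apply/gwa_pi_eq/Cadd0.
Qed.
Fact gwa_addN : left_inverse (gwa_base 0) gwa_opp gwa_add.
Proof.
elim/gwa_ind=> t.
by rewrite -gwa_pi_opp -gwa_pi_add; apply/gwa_pi_eq/CaddN.
Qed.
Fact gwa_mulA : associative gwa_mul.
Proof.
elim/gwa_ind=> t; elim/gwa_ind=> u; elim/gwa_ind=> v.
by rewrite -!gwa_pi_mul; apply/gwa_pi_eq/CmulA.
Qed.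
Fact gwa_mul1l : left_id (gwa_base 1) gwa_mul.
Proof.
by elim/gwa_ind=> t; rewrite /gwa_base -gwa_pi_mul; apply/gwa_pi_eq/Cmul1l.
Qed.
Fact gwa_mul1r : right_id (gwa_base 1) gwa_mul.
Proof.
by elim/gwa_ind=> t; rewrite /gwa_base -gwa_pi_mul; apply/gwa_pi_eq/Cmul1r.
Qed.
Fact gwa_mulDl : left_distributive gwa_mul gwa_add.
Proof.
elim/gwa_ind=> t; elim/gwa_ind=> u; elim/gwa_ind=> v.
by rewrite -gwa_pi_add -!gwa_pi_mul -gwa_pi_add; apply/gwa_pi_eq/CmulDl.
Qed.
Fact gwa_mulDr : right_distributive gwa_mul gwa_add.
Proof.
elim/gwa_ind=> t; elim/gwa_ind=> u; elim/gwa_ind=> v.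
by rewrite -gwa_pi_add -!gwa_pi_mul -gwa_pi_add; apply/gwa_pi_eq/CmulDr.
Qed.

(* 1 <> 0 in the quotient: D(sigma, a) acts on the D-valued functions F of a  *)
(* ring endomorphism tau of D by (d F)(tau) = tau(d) F(tau),                  *)
(* (x F)(tau) = F(tau sigma) and (y F)(tau) = tau(a) F(tau sigma^-1).         *)

Let is_endo (tau : D -> D) : Prop :=
  [/\ {morph tau : d e / d + e}, {morph tau : d e / d * e}
    & tau 1 = 1].
Let endo := {tau : D -> D | is_endo tau}.

Let endo_id : endo.
Proof. by exists idfun. Defined.

Let endo_sigma_subproof tau : is_endo tau -> is_endo (tau \o sigma).
Proof.
move=> [tD tM t1].
by split=> [d e|d e|] /=; rewrite ?rmorphD ?rmorphM ?rmorph1 /= ?tD ?tM.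
Qed.

Let endo_sigmaV_subproof tau : is_endo tau -> is_endo (tau \o aut_inv sigma).
Proof.
move=> [tD tM t1]; have sI := can_inj (autK sigma).
split=> [d e|d e|] /=.
- by rewrite -tD; congr (tau _); apply: sI; rewrite rmorphD /= !autVK.
- by rewrite -tM; congr (tau _); apply: sI; rewrite rmorphM /= !autVK.
- by rewrite -t1; congr (tau _); apply: sI; rewrite rmorph1 /= !autVK.
Qed.

Let endo_sigma (tau : endo) : endo := exist _ _ (endo_sigma_subproof (svalP tau)).
Let endo_sigmaV (tau : endo) : endo :=
  exist _ _ (endo_sigmaV_subproof (svalP tau)).

Let endo_eq (s t : endo) : sval s =1 sval t -> s = t.
Proof. by case: s t => [s Ps] [t Pt] /= /funext st; apply: eq_exist. Qed.

Let endo_sigmaK tau : endo_sigmaV (endo_sigma tau) = tau.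
Proof. by apply: endo_eq => d /=; rewrite autVK. Qed.
Let endo_sigmaVK tau : endo_sigma (endo_sigmaV tau) = tau.
Proof. by apply: endo_eq => d /=; rewrite autK. Qed.

Let endoD (tau : endo) : {morph sval tau : d e / d + e}.
Proof. by case: tau => tau []. Qed.
Let endoM (tau : endo) : {morph sval tau : d e / d * e}.
Proof. by case: tau => tau []. Qed.
Let endo1 (tau : endo) : sval tau 1 = 1.
Proof. by case: tau => tau []. Qed.
Let endo0 (tau : endo) : sval tau 0 = 0.
Proof. by apply: (addrI (sval tau 0)); rewrite -endoD !addr0. Qed.

Let act := fix act (t : gwa_term) (F : endo -> D) (tau : endo) {struct t} : D :=
  match t with
  | TBase d => sval tau d * F tau
  | TX => F (endo_sigma tau)
  | TY => sval tau a * F (endo_sigmaV tau)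
  | TAdd t u => act t F tau + act u F tau
  | TOpp t => - act t F tau
  | TMul t u => act t (act u F) tau
  end.

Let act_add t : forall F G tau,
  act t (fun s => F s + G s) tau = act t F tau + act t G tau.
Proof.
elim: t => [d| | |t IHt u IHu|t IHt|t IHt u IHu] F G tau //=; rewrite ?mulrDr //.
- by rewrite IHt IHu addrACA.
- by rewrite IHt opprD.
- by rewrite -IHt; congr (act t _ tau); apply: funext => s.
Qed.

Let act_cong t u : gwa_cong t u -> act t = act u.
Proof.
suff P : gwa_cong t u -> forall F tau, act t F tau = act u F tau.
  by move=> tu; apply: funext => F; apply: funext => tau; apply: P.
elim=> {t u} //=.
- by move=> t u v _ IH1 _ IH2 F tau; rewrite IH1.
- by move=> t t' u u' _ IH1 _ IH2 F tau; rewrite IH1 IH2.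
- by move=> t t' _ IH F tau; rewrite IH.
- move=> t t' u u' _ IH1 _ IH2 F tau; rewrite IH1.
  by congr (act t' _ tau); apply: funext.
- by move=> t u v F tau; rewrite addrA.
- by move=> t u F tau; rewrite addrC.
- by move=> t F tau; rewrite endo0 mul0r add0r.
- by move=> t F tau; rewrite endo0 mul0r addNr.
- by move=> t F tau; rewrite endo1 mul1r.
- move=> t F tau; congr (act t _ tau).
  by apply: funext => s; rewrite endo1 mul1r.
- by move=> d e F tau; rewrite endoD mulrDl.
- by move=> d e F tau; rewrite endoM mulrA.
- by move=> d F tau; rewrite mulrCA.
- by move=> F tau; rewrite endo_sigmaVK.
- by move=> F tau; rewrite endo_sigmaK.
Qed.

Fact gwa_1_neq0 : gwa_base 1 != gwa_base 0.
Proof.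
apply/eqP => /gwa_pi_cong/act_cong /(congr1 (fun f => f (fun=> 1) endo_id)) /=.
by move/eqP; rewrite !mulr1 oner_eq0.
Qed.

HB.instance Definition _ :=
  GRing.isZmodule.Build gwa gwa_addA gwa_addC gwa_add0 gwa_addN.
HB.instance Definition _ :=
  GRing.Zmodule_isNzRing.Build gwa
    gwa_mulA gwa_mul1l gwa_mul1r gwa_mulDl gwa_mulDr gwa_1_neq0.

Fact gwa_base_is_zmod_morphism : zmod_morphism gwa_base.
Proof.
move=> d e; apply: (addIr (gwa_base e)); rewrite subrK -{2}[d](subrK e).
by rewrite [RHS](gwa_pi_eq (CbaseD _ _)) gwa_pi_add.
Qed.
HB.instance Definition _ :=
  GRing.isZmodMorphism.Build D gwa gwa_base gwa_base_is_zmod_morphism.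

Fact gwa_base_is_monoid_morphism : monoid_morphism gwa_base.
Proof.
by split=> // d e; rewrite [LHS](gwa_pi_eq (CbaseM _ _)) gwa_pi_mul.
Qed.
HB.instance Definition _ :=
  GRing.isMonoidMorphism.Build D gwa gwa_base gwa_base_is_monoid_morphism.

Definition gwa_scale (c : k) (u : gwa) : gwa := gwa_base c%:A * u.

Fact gwa_scaleA c d u : gwa_scale c (gwa_scale d u) = gwa_scale (c * d) u.
Proof.
by rewrite /gwa_scale mulrA -rmorphM /= -scalerAl mul1r scalerA.
Qed.
Fact gwa_scale1 : left_id 1 gwa_scale.
Proof. by move=> u; rewrite /gwa_scale scale1r rmorph1 mul1r. Qed.
Fact gwa_scaleDr : right_distributive gwa_scale +%R.
Proof. by move=> c u v; rewrite /gwa_scale mulrDr. Qed.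
Fact gwa_scaleDl u : {morph gwa_scale^~ u : c d / c + d}.
Proof. by move=> c d; rewrite /gwa_scale scalerDl rmorphD mulrDl. Qed.

HB.instance Definition _ :=
  GRing.Zmodule_isLmodule.Build k gwa
    gwa_scaleA gwa_scale1 gwa_scaleDr gwa_scaleDl.

Fact gwa_scaleAl (c : k) (u v : gwa) : c *: (u * v) = c *: u * v.
Proof. exact: mulrA. Qed.
HB.instance Definition _ := GRing.Lmodule_isLalgebra.Build k gwa gwa_scaleAl.

Lemma gwa_xd d : gwa_x * gwa_base d = gwa_base (sigma d) * gwa_x.
Proof. by rewrite -![_ * _]gwa_pi_mul; apply/gwa_pi_eq/CrelX. Qed.
Lemma gwa_yd d : gwa_y * gwa_base d = gwa_base (aut_inv sigma d) * gwa_y.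
Proof. by rewrite -![_ * _]gwa_pi_mul; apply/gwa_pi_eq/CrelY. Qed.
Lemma gwa_yx : gwa_y * gwa_x = gwa_base a.
Proof. by rewrite -[_ * _]gwa_pi_mul; apply/gwa_pi_eq/CrelYX. Qed.
Lemma gwa_xy : gwa_x * gwa_y = gwa_base (sigma a).
Proof. by rewrite -[_ * _]gwa_pi_mul; apply/gwa_pi_eq/CrelXY. Qed.

Lemma gwa_scalar_central (c : k) (u : gwa) :
  gwa_base c%:A * u = u * gwa_base c%:A.
Proof.
have sc : sigma c%:A = c%:A by rewrite linearZ /= rmorph1.
elim/gwa_ind: u; elim=> [d| | |t IHt u IHu|t IHt|t IHt u IHu].
- by rewrite -!(rmorphM gwa_base) mulrC.
- by rewrite gwa_xd sc.
- by rewrite gwa_yd -{2}sc autK.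
- by rewrite gwa_pi_add mulrDl mulrDr; congr (_ + _).
- by rewrite gwa_pi_opp mulrN mulNr; congr (- _).
- rewrite gwa_pi_mul; set v := \pi_gwa t; set w := \pi_gwa u.
  by rewrite -[gwa_mul v w]/(v * w) mulrA IHt -mulrA IHu mulrA.
Qed.

Fact gwa_scaleAr (c : k) (u v : gwa) : c *: (u * v) = u * (c *: v).
Proof.
by rewrite -![c *: _]/(gwa_base c%:A * _) !mulrA gwa_scalar_central.
Qed.
HB.instance Definition _ := GRing.Lalgebra_isAlgebra.Build k gwa gwa_scaleAr.

Fact gwa_base_is_scalable : scalable gwa_base.
Proof.
move=> c d; rewrite -[c *: gwa_base d]/(gwa_base c%:A * gwa_base d).
by rewrite -rmorphM /= -scalerAl mul1r.
Qed.
HB.instance Definition _ :=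
  GRing.isScalable.Build k D gwa *:%R gwa_base gwa_base_is_scalable.

End GWA.

Inductive base_kind := PolyBase | LaurentBase.

Definition base_ring (k : fieldType) (b : base_kind) : comAlgType k :=
  match b with
  | PolyBase => {poly k} : comAlgType k
  | LaurentBase => laurent k : comAlgType k
  end.

Definition base_h (k : fieldType) (b : base_kind) : base_ring k b :=
  match b return base_ring k b with
  | PolyBase => 'X : {poly k}
  | LaurentBase => laurent_of_poly 'X
  end.

Definition base_of_poly (k : fieldType) (b : base_kind) (p : {poly k}) :
    base_ring k b :=
  horner_alg (base_h k b) p.

Definition is_monomial (k : fieldType) (p : {poly k}) : bool :=
  [exists i : 'I_(size p), p == p`_i *: 'X^i].

Definition support_gcd (k : fieldType) (p : {poly k}) : nat :=
  \big[gcdn/0%N]_(ij : 'I_(size p) * 'I_(size p) | p`_ij.1 * p`_ij.2 != 0)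
     `|(ij.1 : nat)%:Z - (ij.2 : nat)%:Z|%N.

Definition in_Cg (k : fieldType) (p : {poly k}) (gamma : k) : bool :=
  if is_monomial p then gamma != 0 else gamma ^+ support_gcd p == 1.

Definition is_eta (k : fieldType) (b : base_kind) (sigma : algAut (base_ring k b))
    (a : {poly k}) (i0 : nat) (gamma mu : k)
    (eta : algAut (gwa sigma (base_of_poly b a))) : Prop :=
  let h := gwa_base sigma (base_of_poly b a) (base_h k b) in
  let x := gwa_x sigma (base_of_poly b a) in
  let y := gwa_y sigma (base_of_poly b a) in
  [/\ eta h = gamma *: h,
      eta y = mu *: y
    & eta x = (mu^-1 * gamma ^+ i0) *: x].

(* Main.v *)
Require Import Defs.
From HB Require Import structures.
From mathcomp Require Import all_boot all_order all_algebra.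
From mathcomp Require Import boolp zify.
Import Order.TTheory GRing.Theory Num.Theory.
Local Open Scope ring_scope.
Set Implicit Arguments.
Unset Strict Implicit.
Unset Printing Implicit Defensive.

(* The fixed ring is generated by h^n, x^m, y^m, and an isomorphism gives an  *)
(* injective endomorphism theta of R with image the fixed ring.               *)
(* First, theta(h) = c h^n, or c h^-n in the Laurent case, where this follows *)
(* from the description of the units of R.  For D = k[h], there are two maps  *)
(* R -> k(z) killing h, sending x resp. y to z, with common kernel h R.  If   *)
(* theta(h) is not killed, then theta(x) and theta(y), which q-commute with   *)
(* it, are killed, hence so is a(theta(h)), and all of theta(R) has an image  *)
(* algebraic over k; this is absurd, since theta is onto the fixed ring.  So  *)
(* theta(h) lies in h^n theta(R), and the same argument for theta^-1 shows    *)
(* that it generates this ideal.                                              *)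
(* Secondly, theta(y) theta(x) = a(theta(h)) has degree 0 in the Z-grading,   *)
(* so theta(x) and theta(y) are homogeneous, and as they generate x^m and y^m *)
(* they are equal to these up to units and exchange.  Comparing a(theta(h))   *)
(* with y^m x^m = a(h) a(q^-1 h) ... a(q^(1-m) h), of degree m deg(a), gives  *)
(* n = m, hence n = m = 1 by coprimality.                                     *)

(** What distinguishes the fixed ring from [R] is the degree of the defining polynomial. As gcd(n,
    m) = 1, a monomial h^u z^i (z^i being x^i or y^-i) is fixed only if n | u and m | i
    ([weight_coprime]). The fixed ring therefore resembles a GWA with h^n, x^m, y^m in the roles of
    h, x, y; its defining polynomial y^m x^m has degree m N_a in h, that is m N_a / n in h^n. If it
    is isomorphic to [R], this number has to be N_a, so n = m, and coprimality makes both orders 1.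

    To compare the two degrees, an isomorphism is turned into an injective endomorphism [theta] of
    [R] onto the fixed ring, and one shows that [theta] sends h to a scalar multiple of h^n or h^-n
    ([theta_h_laurent], [theta_h_poly]). Then [theta_mutual_multiple] shows that a(theta(h)) and y^m
    x^m (or x^m y^m) agree up to a unit of the base, and [degree_count] compares degrees. The
    grading arguments rest on an embedding of [R] into twisted Laurent series ([zcoef_inj]), which
    makes [R] a domain and factors of elements of degree 0 homogeneous ([gwa_domain],
    [homog_factors]). *)

Section AlgAut.
Variables (k : fieldType) (A : algType k) (s : algAut A).
Let sI := can_inj (autK s).

Lemma aut_invD : {morph aut_inv s : u v / u + v}.
Proof. by move=> u v; apply: sI; rewrite rmorphD /= !autVK. Qed.
Lemma aut_invM : {morph aut_inv s : u v / u * v}.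
Proof. by move=> u v; apply: sI; rewrite rmorphM /= !autVK. Qed.
Lemma aut_inv0 : aut_inv s 0 = 0.
Proof. by apply: sI; rewrite autVK rmorph0. Qed.

Definition aut_expz (i : int) (d : A) : A :=
  match i with
  | Posz n => iter n s d
  | Negz n => iter n.+1 (aut_inv s) d
  end.

Lemma aut_expzS i d : s (aut_expz i d) = aut_expz (i + 1) d.
Proof.
case: i => [n|[|n]] /=; first by rewrite addn1.
  by rewrite autVK.
by rewrite autVK subn1.
Qed.
Lemma aut_expzP i d : aut_inv s (aut_expz i d) = aut_expz (i - 1) d.
Proof. by rewrite -[in LHS](subrK 1 i) -aut_expzS autK. Qed.
Lemma aut_expz0 i : aut_expz i 0 = 0.
Proof.
case: i => n /=; first by elim: n => //= n ->; rewrite rmorph0.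
by elim: n => /= [|n ->]; rewrite aut_inv0.
Qed.
Lemma aut_expz_eq0 i d : aut_expz i d = 0 -> d = 0.
Proof.
have s0 u : s u = 0 -> u = 0 by move=> su; apply: sI; rewrite rmorph0.
have si0 u : aut_inv s u = 0 -> u = 0.
  by move=> su; rewrite -[u](autVK s) su rmorph0.
case: i => n /=; first by elim: n => //= n IH /s0.
by move/si0; elim: n => //= n IH /si0.
Qed.
End AlgAut.

(** * Normal forms, the Z-grading, and the domain property of a GWA *)

Section GWABasis.
Local Open Scope quotient_scope.
Variables (k : fieldType) (D : comAlgType k) (sigma : algAut D) (a : D).
Hypothesis D_domain : forall d e : D, d * e = 0 -> d = 0 \/ e = 0.
Hypothesis a_neq0 : a <> 0.
Local Notation R := (gwa sigma a).
Local Notation base := (gwa_base sigma a).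
Local Notation x := (gwa_x sigma a).
Local Notation y := (gwa_y sigma a).
Local Notation term := (gwa_term D).

Lemma gwa_ind (P : R -> Prop) :
    (forall d, P (base d)) -> P x -> P y ->
    (forall r s, P r -> P s -> P (r + s)) ->
    (forall r s, P r -> P s -> P (r * s)) ->
  forall r, P r.
Proof.
move=> Pd Px Py PD PM r; rewrite -[r]reprK.
elim: (repr r) => [d| | |t IHt u IHu|t IHt|t IHt u IHu].
- exact: Pd.
- exact: Px.
- exact: Py.
- by rewrite gwa_pi_add; apply: PD.
- rewrite gwa_pi_opp -[gwa_opp _]/(- (\pi_R t)) -mulN1r.
  by rewrite -(rmorph1 base) -rmorphN; apply: PM => //; apply: Pd.
- by rewrite gwa_pi_mul; apply: PM.
Qed.

Definition zmon (i : int) : R :=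
  match i with Posz n => x ^+ n | Negz n => y ^+ n.+1 end.

Lemma x_zmon i : exists c, x * zmon i = base c * zmon (i + 1).
Proof.
case: i => [n|[|n]] /=.
- by exists 1; rewrite rmorph1 mul1r addn1 exprS.
- by exists (sigma a); rewrite expr1 gwa_xy mulr1.
- by exists (sigma a); rewrite subn1 exprS mulrA gwa_xy.
Qed.
Lemma y_zmon i : exists c, y * zmon i = base c * zmon (i - 1).
Proof.
case: i => [[|n]|n] /=.
- by exists 1; rewrite rmorph1 mul1r mulr1.
- by exists a; rewrite exprS mulrA gwa_yx subn1.
- by exists 1; rewrite rmorph1 mul1r addn0 -exprS.
Qed.

Lemma gwa_span_ind (P : R -> Prop) :
    (forall d i, P (base d * zmon i)) ->
    (forall r s, P r -> P s -> P (r + s)) ->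
  forall r, P r.
Proof.
move=> Pm PD r0.
(* [S] is the additive span of the monomials, encoded by its induction principle. It contains 1, so
   it is everything once it is stable under left multiplication by [R]. *)
pose S (s : R) := forall P : R -> Prop, (forall d i, P (base d * zmon i)) ->
    (forall r s, P r -> P s -> P (r + s)) -> P s.
suff: S r0 by apply.
suff Q : forall r s, S s -> S (r * s).
  rewrite -[r0]mulr1; apply: Q => P' Pm' _.
  by rewrite -[1]mulr1 -(rmorph1 base); apply: (Pm' _ 0).
elim/gwa_ind => [d| | |r s IHr IHs|r s IHr IHs] t St.
- move=> P' Pm' PD'; apply: (St (fun u => P' (base d * u))) => [e i|u v].
    by rewrite mulrA -rmorphM; apply: Pm'.
  by rewrite mulrDr; apply: PD'.
- move=> P' Pm' PD'; apply: (St (fun u => P' (x * u))) => [e i|u v].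
    have [c xc] := x_zmon i.
    by rewrite mulrA gwa_xd -mulrA xc mulrA -rmorphM; apply: Pm'.
  by rewrite mulrDr; apply: PD'.
- move=> P' Pm' PD'; apply: (St (fun u => P' (y * u))) => [e i|u v].
    have [c yc] := y_zmon i.
    by rewrite mulrA gwa_yd -mulrA yc mulrA -rmorphM; apply: Pm'.
  by rewrite mulrDr; apply: PD'.
- move=> P' Pm' PD'; rewrite mulrDl.
  by apply: (PD'); [exact: IHr St _ Pm' PD' | exact: IHs St _ Pm' PD'].
- by rewrite -mulrA; exact: (IHr _ (IHs _ St)).
Qed.

(** [Negz i] stands for -(i+1), so the indices run over -J <= i < J. *)
Definition int_sum (V : nmodType) (J : nat) (F : int -> V) : V :=
  \sum_(i < J) (F (Posz i) + F (Negz i)).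

Lemma int_sum_only (V : nmodType) J (F : int -> V) l :
  (`|l| < J)%N -> (forall i, i != l -> F i = 0) -> int_sum J F = F l.
Proof.
move=> lJ Fl; rewrite /int_sum.
have iJ : ((if l is Negz n then n else `|l|) < J)%N by case: l lJ {Fl} => n /=; lia.
rewrite (bigD1 (Ordinal iJ)) //= big1 ?addr0.
  case: l lJ Fl {iJ} => n lJ Fl /=; last by rewrite Fl ?add0r.
  by rewrite [F (Negz n)]Fl ?addr0.
move=> i; rewrite -val_eqE /= => il.
by rewrite !Fl ?addr0 //; case: l il {lJ Fl iJ} => n /=; lia.
Qed.

Lemma int_sum_rmorph (V W : nmodType) (f : {additive V -> W}) J F :
  f (int_sum J F) = int_sum J (fun i => f (F i)).
Proof. by rewrite raddf_sum; apply: eq_bigr => i _; rewrite raddfD. Qed.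

Lemma int_sum_eq (V : nmodType) J (F G : int -> V) :
  F =1 G -> int_sum J F = int_sum J G.
Proof. by move=> FG; apply: eq_bigr => i _; rewrite !FG. Qed.

Lemma int_sumB (V : zmodType) J (F G : int -> V) :
  int_sum J F - int_sum J G = int_sum J (fun i => F i - G i).
Proof.
by rewrite /int_sum -sumrB; apply: eq_bigr => i _; rewrite opprD addrACA.
Qed.

Lemma int_sum_exists (V : nmodType) J (F : int -> V) :
  int_sum J F <> 0 -> exists i, F i <> 0.
Proof.
apply: contra_notP => /forallNP F0; rewrite /int_sum big1 // => i _.
by rewrite (contrapT (F0 (Posz i))) (contrapT (F0 (Negz i))) addr0.
Qed.

(** The range [J] is left free above a bound so that several expansions can share one range. *)
Lemma gwa_normal_form (r : R) : exists (d : int -> D) (J0 : nat),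
  forall J, (J0 <= J)%N -> r = int_sum J (fun i => base (d i) * zmon i).
Proof.
elim/gwa_span_ind: r => [d i|r s [d [J0 rd]] [e [J1 se]]].
  exists (fun j => if j == i then d else 0), `|i|.+1 => J iJ.
  rewrite (int_sum_only (l := i)) ?eqxx // => j /negPf ->.
  by rewrite rmorph0 mul0r.
exists (fun j => d j + e j), (maxn J0 J1) => J; rewrite geq_max => /andP[J0J J1J].
rewrite {1}(rd J) // {1}(se J) // -big_split; apply: eq_bigr => i _ /=.
by rewrite !rmorphD /= !mulrDl addrACA.
Qed.

(* Left multiplication on the twisted Laurent series in z over D, written as  *)
(* functions [int -> D], under [x |-> z] and [y |-> a z^-1].                  *)
Fixpoint act (t : term) (F : int -> D) : int -> D :=
  match t with
  | TBase d => fun i => d * F i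
  | TX => fun i => sigma (F (i - 1))
  | TY => fun i => a * aut_inv sigma (F (i + 1))
  | TAdd t u => fun i => act t F i + act u F i
  | TOpp t => fun i => - act t F i
  | TMul t u => act t (act u F)
  end.

Lemma act_add t F G i : act t (fun j => F j + G j) i = act t F i + act t G i.
Proof.
elim: t F G i => [d| | |t IHt u IHu|t IHt|t IHt u IHu] F G i /=.
- by rewrite mulrDr.
- by rewrite rmorphD.
- by rewrite aut_invD mulrDr.
- by rewrite IHt IHu addrACA.
- by rewrite IHt opprD.
- by rewrite -IHt; congr (act t _ i); apply: funext => j; rewrite IHu.
Qed.

Lemma act_cong t u : gwa_cong sigma a t u -> act t = act u.
Proof.
move=> tu; apply: funext => F; apply: funext => i.
elim: tu F i => {t u} //=.
- by move=> t u v _ IH1 _ IH2 F i; rewrite IH1.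
- by move=> t t' u u' _ IH1 _ IH2 F i; rewrite IH1 IH2.
- by move=> t t' _ IH F i; rewrite IH.
- move=> t t' u u' _ IH1 _ IH2 F i; rewrite IH1.
  by congr (act t' _ i); apply: funext.
- by move=> t u v F i; rewrite addrA.
- by move=> t u F i; rewrite addrC.
- by move=> t F i; rewrite mul0r add0r.
- by move=> t F i; rewrite mul0r addNr.
- by move=> t F i; rewrite mul1r.
- by move=> t F i; congr (act t _ i); apply: funext => j; rewrite mul1r.
- by move=> t u v F i; rewrite act_add.
- by move=> d e F i; rewrite mulrDl.
- by move=> d e F i; rewrite mulrA.
- by move=> d F i; rewrite rmorphM.
- by move=> d F i; rewrite aut_invM mulrCA.
- by move=> F i; rewrite autK addrK.
- by move=> F i; rewrite rmorphM /= autVK subrK.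
Qed.

(** Right multiplication by d z^j turns F(i) z^i into F(i) sigma^i(d) z^(i+j), and commutes with
    left multiplications. *)
Lemma act_rmul t F j d i :
  act t (fun l => F (l - j) * aut_expz sigma (l - j) d) i
  = act t F (i - j) * aut_expz sigma (i - j) d.
Proof.
elim: t F i => [e| | |t IHt u IHu|t IHt|t IHt u IHu] F i /=.
- by rewrite mulrA.
- by rewrite rmorphM /= aut_expzS addrAC [i - j - 1 + 1]subrK.
- by rewrite aut_invM aut_expzP mulrA addrAC addrK.
- by rewrite IHt IHu mulrDl.
- by rewrite IHt mulNr.
- by rewrite -IHt; congr (act t _ i); apply: funext => l; rewrite IHu.
Qed.

Definition delta0 (i : int) : D := if i == 0 then 1 else 0.
(** The coefficients of the image of [r] in the twisted Laurent series, obtained by letting [r] act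
    on the series 1. As y goes to a z^-1, in negative degrees they are not the coefficients of the
    normal form. *)
Definition zcoef (r : R) : int -> D := act (repr r) delta0.

Lemma act_repr t : act (repr (\pi_R t)) = act t.
Proof. exact/act_cong/gwa_cong_repr. Qed.

Lemma zcoefD r s i : zcoef (r + s) i = zcoef r i + zcoef s i.
Proof. by rewrite /zcoef -[r + s]/(gwa_add r s) act_repr. Qed.
Lemma zcoefE r s i : zcoef (r * s) i = act (repr r) (zcoef s) i.
Proof. by rewrite /zcoef -[r * s]/(gwa_mul r s) act_repr. Qed.
Lemma zcoef_base d i : zcoef (base d) i = if i == 0 then d else 0.
Proof.
by rewrite /zcoef act_repr /= /delta0; case: eqP; rewrite ?mulr1 ?mulr0.
Qed.
Lemma zcoef_baseM d r i : zcoef (base d * r) i = d * zcoef r i.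
Proof. by rewrite zcoefE act_repr. Qed.
Lemma zcoef_xM r i : zcoef (x * r) i = sigma (zcoef r (i - 1)).
Proof. by rewrite zcoefE act_repr. Qed.
Lemma zcoef_yM r i : zcoef (y * r) i = a * aut_inv sigma (zcoef r (i + 1)).
Proof. by rewrite zcoefE act_repr. Qed.

Lemma zcoef0 i : zcoef 0 i = 0.
Proof. by rewrite -(rmorph0 base) zcoef_base if_same. Qed.
Lemma zcoefN r i : zcoef (- r) i = - zcoef r i.
Proof. by apply: (addrI (zcoef r i)); rewrite -zcoefD !subrr zcoef0. Qed.

Lemma zcoef_int_sum J F i :
  zcoef (int_sum J F) i = int_sum J (fun j => zcoef (F j) i).
Proof.
rewrite /int_sum; elim: J => [|J IH]; first by rewrite !big_ord0 zcoef0.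
by rewrite !big_ord_recr /= !zcoefD IH.
Qed.

Lemma act_int_sum t J (F : int -> int -> D) i :
  act t (fun l => int_sum J (fun j => F j l)) i
  = int_sum J (fun j => act t (F j) i).
Proof.
rewrite /int_sum; elim: J => [|J IH].
  rewrite big_ord0; under eq_fun do rewrite big_ord0.
  have := act_add t (fun=> 0) (fun=> 0) i; under [in LHS]eq_fun do rewrite addr0.
  by rewrite -[LHS]addr0 => /addrI.
under eq_fun do rewrite big_ord_recr /=.
by rewrite !act_add IH big_ord_recr.
Qed.

Lemma zcoefM r s J l : (forall j, (J <= `|j|)%N -> zcoef s j = 0) ->
  zcoef (r * s) l
  = int_sum J (fun j => zcoef r (l - j) * aut_expz sigma (l - j) (zcoef s j)).
Proof.
move=> sJ; rewrite zcoefE.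
(* Split the series of [s] into monomials, each a right multiple of 1; [act_rmul] then reduces the
   action of [r] to its action on 1. *)
have sE : zcoef s = fun i => int_sum J (fun j =>
    delta0 (i - j) * aut_expz sigma (i - j) (zcoef s j)).
  apply: funext => i; have [Ji|iJ] := leqP J `|i|%N.
    have F0 j : delta0 (i - j) * aut_expz sigma (i - j) (zcoef s j) = 0.
      rewrite /delta0; case: eqP => [/eqP|]; last by rewrite mul0r.
      by rewrite subr_eq0 => /eqP <-; rewrite sJ // aut_expz0 mulr0.
    by rewrite sJ // /int_sum big1 // => j _; rewrite !F0 addr0.
  rewrite (int_sum_only (l := i)) //; first by rewrite subrr /delta0 eqxx mul1r.
  by move=> j ji; rewrite /delta0 ifF ?mul0r //; apply/eqP; lia.
by rewrite {1}sE act_int_sum; apply: int_sum_eq => j; rewrite act_rmul.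
Qed.

Lemma zcoef_zmon_neq i j : j != i -> zcoef (zmon i) j = 0.
Proof.
case: i => n /= ji.
  elim: n j ji => [|n IH] j ji.
    by rewrite expr0 -(rmorph1 base) zcoef_base (negPf ji).
  by rewrite exprS zcoef_xM IH ?rmorph0 //; apply: contra ji; lia.
elim: n j ji => [|n IH] j ji; rewrite exprS zcoef_yM.
  rewrite expr0 -(rmorph1 base) zcoef_base ifF ?aut_inv0 ?mulr0 //.
  by apply: contraNF ji; lia.
by rewrite IH ?aut_inv0 ?mulr0 //; apply: contra ji; lia.
Qed.

(** x^n has coefficient 1, and y^n a product of images of [a] under powers of the inverse of
    [sigma], nonzero in a domain. *)
Lemma zcoef_zmon_neq0 i : zcoef (zmon i) i <> 0.
Proof.
case: i => n /=.
  elim: n => [|n IH].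
    by rewrite expr0 -(rmorph1 base) zcoef_base eqxx; apply/eqP/oner_neq0.
  rewrite exprS zcoef_xM -addn1 PoszD addrK => s0; apply: IH.
  by apply: (can_inj (autK sigma)); rewrite s0 rmorph0.
have aut0 d : a * aut_inv sigma d = 0 -> d = 0.
  by case/D_domain => // s0; rewrite -[d](autVK sigma) s0 rmorph0.
elim: n => [|n IH]; rewrite exprS zcoef_yM => /aut0.
  by rewrite expr0 -(rmorph1 base) zcoef_base; apply/eqP/oner_neq0.
by rewrite (_ : Negz n.+1 + 1 = Negz n) //; lia.
Qed.

Lemma zcoef_mon d i j :
  zcoef (base d * zmon i) j = if j == i then d * zcoef (zmon i) i else 0.
Proof.
by rewrite zcoef_baseM; case: eqP => [->//|/eqP ji]; rewrite zcoef_zmon_neq ?mulr0.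
Qed.

Lemma zcoef_mon_eq0 d i : zcoef (base d * zmon i) i = 0 -> d = 0.
Proof. by rewrite zcoef_mon eqxx => /D_domain[] // /zcoef_zmon_neq0. Qed.

Lemma zcoef_normal_form (d : int -> D) J i : (`|i| < J)%N ->
  zcoef (int_sum J (fun j => base (d j) * zmon j)) i = d i * zcoef (zmon i) i.
Proof.
move=> iJ; rewrite zcoef_int_sum (int_sum_only (l := i)) ?zcoef_mon ?eqxx //.
by move=> j ji; rewrite zcoef_mon eq_sym (negPf ji).
Qed.

Lemma normal_form_eq0 (d : int -> D) (J0 : nat) :
    (forall J, (J0 <= J)%N -> int_sum J (fun j => base (d j) * zmon j) = 0) ->
  forall i, d i = 0.
Proof.
move=> d0 i; apply: (@zcoef_mon_eq0 _ i); rewrite zcoef_mon eqxx.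
rewrite -(zcoef_normal_form d (J := maxn J0 `|i|.+1)) ?leq_max ?ltnSn ?orbT //.
by rewrite d0 ?leq_maxl // zcoef0.
Qed.

(** Faithfulness of the series representation: z^i has a nonzero coefficient in degree i and none
    elsewhere, so a normal form with zero image has zero coefficients. *)
Lemma zcoef_inj r s : zcoef r =1 zcoef s -> r = s.
Proof.
move=> rs; apply/eqP; rewrite -subr_eq0; apply/eqP.
have {rs}: forall i, zcoef (r - s) i = 0.
  by move=> i; rewrite zcoefD zcoefN rs subrr.
move: (r - s) => {r s} r r0; have [d [J rd]] := gwa_normal_form r.
have dz i : d i = 0.
  apply: (@zcoef_mon_eq0 _ i); rewrite zcoef_mon eqxx.
  rewrite -(zcoef_normal_form d (J := maxn J `|i|.+1)) ?leq_max ?ltnSn ?orbT //.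
  by rewrite -rd ?leq_maxl.
by rewrite (rd _ (leqnn J)) /int_sum big1 // => i _;
  rewrite !dz !rmorph0 !mul0r addr0.
Qed.

Lemma zcoef_bounded r : exists J, forall i, (J <= `|i|)%N -> zcoef r i = 0.
Proof.
have [d [J rd]] := gwa_normal_form r; exists J.+1 => i iJ.
rewrite (rd _ (leqnn J)) zcoef_int_sum /int_sum big1 // => j _.
by rewrite !zcoef_mon !ifF ?addr0 //; apply/eqP; move: (ltn_ord j) iJ; lia.
Qed.

Definition homog (i : int) (r : R) := forall j, j != i -> zcoef r j = 0.

Lemma homog_mon d i : homog i (base d * zmon i).
Proof. by move=> j /negPf ji; rewrite zcoef_mon ji. Qed.

Lemma homog_base d : homog 0 (base d).
Proof. by move=> j /negPf j0; rewrite zcoef_base j0. Qed.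

Lemma homogE i r : homog i r -> exists d, r = base d * zmon i.
Proof.
move=> ri; have [d [J0 rd]] := gwa_normal_form r.
exists (d i); apply: zcoef_inj => j; have [->|ji] := eqVneq j i; last first.
  by rewrite ri // homog_mon.
rewrite zcoef_mon eqxx -(zcoef_normal_form d (J := maxn J0 `|i|.+1)).
  by rewrite -rd // leq_maxl.
by rewrite leq_max ltnSn orbT.
Qed.

Lemma homogM i j r s : homog i r -> homog j s ->
  homog (i + j) (r * s) /\
  zcoef (r * s) (i + j) = zcoef r i * aut_expz sigma i (zcoef s j).
Proof.
move=> ri sj; have sJ : forall l, (`|j|.+1 <= `|l|)%N -> zcoef s l = 0.
  by move=> l jl; apply: sj; apply: contraL jl => /eqP ->; rewrite ltnn.
have rsE l : zcoef (r * s) l = zcoef r (l - j) * aut_expz sigma (l - j) (zcoef s j).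
  rewrite (zcoefM r l sJ) (int_sum_only (l := j)) // => m mj.
  by rewrite sj // aut_expz0 mulr0.
split; last by rewrite rsE addrK.
by move=> l lij; rewrite rsE ri ?mul0r // subr_eq.
Qed.

(** [e] is 1 for the highest degree and -1 for the lowest, so that one argument serves both ends. *)
Definition top_degree (e : int) (r : R) (t : int) :=
  zcoef r t <> 0 /\ forall i, e * t < e * i -> zcoef r i = 0.

Lemma top_degree_exists (e : int) r : (e = 1) \/ (e = -1) -> r <> 0 ->
  exists t, top_degree e r t.
Proof.
move=> e1 r0; have [J rJ] := zcoef_bounded r.
have [i0 ri0] : exists i, zcoef r i <> 0.
  apply: contra_notP r0 => /forallNP r0; apply: zcoef_inj => i.
  by rewrite zcoef0; apply: contrapT (r0 i).
(* [n] is the distance from the bound [J] on the side selected by [e]; the least one gives the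
   extreme degree. *)
pose f n := zcoef r (e * (J%:Z - n%:Z)) != 0.
have fex : exists n, f n.
  have i0J : (`|i0| < J)%N by rewrite ltnNge; apply/negP => /rJ.
  exists (absz (J%:Z - e * i0)%R); rewrite /f; apply/eqP.
  by rewrite (_ : e * _ = i0) //; case: e1 => ->; lia.
case: (ex_minnP fex) => n /eqP fn nmin; exists (e * (J%:Z - n%:Z)); split=> // i.
move=> ei; apply: contrapT => ri.
have iJ : (`|i| < J)%N by rewrite ltnNge; apply/negP => /rJ.
suff /nmin : f (absz (J%:Z - e * i)%R).
  by move=> ni; move: ei ni iJ; case: e1 => ->; lia.
rewrite /f; apply/eqP; rewrite (_ : e * _ = i) //.
by move: iJ; case: e1 => ->; lia.
Qed.

Lemma top_degreeM e r s t u : (e = 1) \/ (e = -1) -> top_degree e r t ->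
  top_degree e s u -> zcoef (r * s) (t + u) <> 0.
Proof.
move=> e1 [rt rtop] [su stop]; have [J sJ] := zcoef_bounded s.
rewrite (zcoefM r (t + u) sJ) (int_sum_only (l := u)).
- by rewrite addrK => /D_domain[] // /aut_expz_eq0.
- by rewrite ltnNge; apply/negP => /sJ.
move=> j ju; have [uj|ju'] := boolP (e * u < e * j).
  by rewrite stop // aut_expz0 mulr0.
rewrite rtop ?mul0r //; move: ju ju'; case: e1 => ->; lia.
Qed.

Lemma gwa_domain (r s : R) : r * s = 0 -> r = 0 \/ s = 0.
Proof.
move=> rs; have [|r0] := pselect (r = 0); first by left.
have [|s0] := pselect (s = 0); first by right.
have p1 : (1 : int) = 1 \/ (1 : int) = -1 by left.
have [t rt] := top_degree_exists p1 r0; have [u su] := top_degree_exists p1 s0.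
by have := top_degreeM p1 rt su; rewrite rs zcoef0.
Qed.

(* Compare the top degrees and the bottom degrees of the two factors. *)
Lemma homog_factors (r s : R) : homog 0 (r * s) -> r * s <> 0 ->
  exists i, homog i r /\ homog (- i) s.
Proof.
move=> rs0 rs.
have r0 : r <> 0 by move=> r0; rewrite r0 mul0r in rs.
have s0 : s <> 0 by move=> s0; rewrite s0 mulr0 in rs.
have p1 : (1 : int) = 1 \/ (1 : int) = -1 by left.
have m1 : (-1 : int) = 1 \/ (-1 : int) = -1 by right.
have [t rt] := top_degree_exists p1 r0; have [u su] := top_degree_exists p1 s0.
have [t' rt'] := top_degree_exists m1 r0; have [u' su'] := top_degree_exists m1 s0.
have tu : t + u = 0.
  by apply/eqP; apply: contra_notT (top_degreeM p1 rt su) => /rs0.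
have tu' : t' + u' = 0.
  by apply/eqP; apply: contra_notT (top_degreeM m1 rt' su') => /rs0.
have [[rtN rtop] [sN stop]] := (rt, su).
have [[rtN' rbot] [sN' sbot]] := (rt', su').
have tt' : t' <= t.
  by rewrite leNgt; apply/negP => tt'; apply: rtN'; apply: rtop; lia.
have uu' : u' <= u.
  by rewrite leNgt; apply/negP => uu'; apply: sN'; apply: stop; lia.
exists t; split=> j jt.
  have [|jt'] := boolP (t < j); first by move=> ?; apply: rtop; lia.
  by apply: rbot; lia.
have [|jt'] := boolP (u < j); first by move=> ?; apply: stop; lia.
by apply: sbot; lia.
Qed.

Lemma base_inj : injective base.
Proof. by move=> d e de; have := zcoef_base d 0; rewrite de zcoef_base. Qed.

(** The leftmost y acts as a z^-1. *)
Lemma zcoef_homog_neg n (r : R) :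
  homog (Negz n) r -> exists f, zcoef r (Negz n) = a * f.
Proof.
move=> /homogE[d ->]; rewrite zcoef_baseM /= exprS zcoef_yM.
by rewrite mulrCA; eexists.
Qed.

(** Factors of 1 are homogeneous of opposite degrees. If these were not 0, the coefficient of the
    factor of negative degree would be both invertible and divisible by [a]. *)
Lemma gwa_unit (r s : R) : r * s = 1 -> (forall e, a * e <> 1) ->
  exists d e, [/\ r = base d, s = base e & d * e = 1].
Proof.
move=> rs a_nunit.
have s0 : s <> 0.
  by move=> s0; move: rs; rewrite s0 mulr0 => /esym/eqP; rewrite oner_eq0.
have sr : s * r = 1.
  have /gwa_domain[] : (s * r - 1) * s = 0.
      by rewrite mulrBl -mulrA rs mulr1 mul1r subrr.
    by move/eqP; rewrite subr_eq0 => /eqP.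
  by [].
have one0 : homog 0 (1 : R) by rewrite -(rmorph1 base); apply: homog_base.
have unit_homog (i : int) u v : homog i u -> homog (- i) v -> u * v = 1 ->
    zcoef u i * aut_expz sigma i (zcoef v (- i)) = 1.
  move=> ui vi uv; have [_] := homogM ui vi.
  by rewrite uv subrr -(rmorph1 base) zcoef_base eqxx.
have [i [ri si]] : exists i, homog i r /\ homog (- i) s.
  by apply: homog_factors; rewrite rs //; apply/eqP/oner_neq0.
have ri' : homog (- - i) r by rewrite opprK.
have := unit_homog _ _ _ si ri' sr; have := unit_homog _ _ _ ri si rs.
case: i ri si {ri'} => [[|n]|n] ri si.
- move=> _ _; have [[d rd] [e se]] := (homogE ri, homogE si).
  rewrite !mulr1 in rd se; exists d, e; split=> //.
  by apply: base_inj; rewrite rmorphM /= rmorph1 -rd -se.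
- by have [f ->] := zcoef_homog_neg si; rewrite -mulrA => _ /a_nunit.
- by have [f ->] := zcoef_homog_neg ri; rewrite -mulrA => /a_nunit.
Qed.
End GWABasis.

(** * Commutation with the base, and the universal property *)

Section GWACommutation.
Variables (k : fieldType) (D : comAlgType k) (sigma : algAut D) (a : D).

Lemma zmon_base i d : zmon sigma a i * gwa_base sigma a d
  = gwa_base sigma a (aut_expz sigma i d) * zmon sigma a i.
Proof.
case: i => n /=.
  elim: n => [|n IH]; first by rewrite !expr0 mulr1 mul1r.
  by rewrite exprS -mulrA IH mulrA gwa_xd -mulrA.
elim: n => [|n IH] /=; first by rewrite !expr1 gwa_yd.
by rewrite exprS -mulrA IH mulrA gwa_yd -mulrA.
Qed.
End GWACommutation.

Section GWALift.
Local Open Scope quotient_scope.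
Variables (k : fieldType) (D : comAlgType k) (sigma : algAut D) (a : D).
Variables (E : nzRingType) (f : {rmorphism D -> E}) (u v : E).
Hypothesis uf : forall d, u * f d = f (sigma d) * u.
Hypothesis vf : forall d, v * f d = f (aut_inv sigma d) * v.
Hypothesis vu : v * u = f a.
Hypothesis uv : u * v = f (sigma a).
Local Notation R := (gwa sigma a).

Fixpoint term_eval (t : gwa_term D) : E :=
  match t with
  | TBase d => f d
  | TX => u
  | TY => v
  | TAdd t t' => term_eval t + term_eval t'
  | TOpp t => - term_eval t
  | TMul t t' => term_eval t * term_eval t'
  end.

Lemma term_eval_cong t t' : gwa_cong sigma a t t' -> term_eval t = term_eval t'.
Proof.
elim=> {t t'} //=.
- by move=> t t' t'' _ -> _ ->.
- by move=> t t' w w' _ -> _ ->.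
- by move=> t t' _ ->.
- by move=> t t' w w' _ -> _ ->.
- by move=> t t' w; rewrite addrA.
- by move=> t t'; rewrite addrC.
- by move=> t; rewrite rmorph0 add0r.
- by move=> t; rewrite rmorph0 addNr.
- by move=> t t' w; rewrite mulrA.
- by move=> t; rewrite rmorph1 mul1r.
- by move=> t; rewrite rmorph1 mulr1.
- by move=> t t' w; rewrite mulrDl.
- by move=> t t' w; rewrite mulrDr.
- by move=> d e; rewrite rmorphD.
- by move=> d e; rewrite rmorphM.
Qed.

Lemma gwa_lift_exists : exists F : {rmorphism R -> E},
  [/\ forall d, F (gwa_base sigma a d) = f d, F (gwa_x sigma a) = u
    & F (gwa_y sigma a) = v].
Proof.
pose F (r : R) := term_eval (repr r).
have Fpi t : F (\pi_R t) = term_eval t by apply/term_eval_cong/gwa_cong_repr.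
have FD r s : F (r + s) = F r + F s by rewrite -[r + s]/(gwa_add r s) Fpi.
have FN r : F (- r) = - F r by rewrite -[- r]/(gwa_opp r) Fpi.
have FM r s : F (r * s) = F r * F s by rewrite -[r * s]/(gwa_mul r s) Fpi.
have F1 : F 1 = 1 by rewrite Fpi /= rmorph1.
have Fz : zmod_morphism F by move=> r s; rewrite FD FN.
have Fm : monoid_morphism F by split.
pose Fa := GRing.isZmodMorphism.Build R E F Fz.
pose Fb := GRing.isMonoidMorphism.Build R E F Fm.
pose G : {rmorphism R -> E} := HB.pack F Fa Fb.
by exists G; split=> [d||] /=; rewrite Fpi.
Qed.
End GWALift.

(** * The two base rings, polynomials, and units *)

Section BaseRing.
Variables (k : fieldType) (b : base_kind).
Local Notation D := (base_ring k b).
Local Notation h := (base_h k b).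
Local Notation P := (@base_of_poly k b).

Lemma base_of_polyE p : P p = horner_alg h p. Proof. by []. Qed.

Lemma base_of_polyX : P 'X = h.
Proof. by rewrite base_of_polyE horner_algX. Qed.
Lemma base_of_polyXn n : P 'X^n = h ^+ n.
Proof. by rewrite base_of_polyE rmorphXn /= horner_algX. Qed.
Lemma base_of_polyC c : P c%:P = c%:A.
Proof. by rewrite base_of_polyE horner_algC. Qed.

Lemma val_base_of_poly_poly (p : {poly k}) : base_of_poly PolyBase p = p.
Proof.
rewrite /base_of_poly; elim/poly_ind: p => [|p c IH]; first by rewrite rmorph0.
by rewrite rmorphD rmorphM /= horner_algX horner_algC IH /= alg_polyC.
Qed.

Lemma val_base_of_poly_laurent (p : {poly k}) :
  laurent_val (base_of_poly LaurentBase p) = FracField.tofrac p.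
Proof.
rewrite /base_of_poly; elim/poly_ind: p => [|p c IH].
  by rewrite !rmorph0.
rewrite rmorphD rmorphM /= horner_algX horner_algC IH /=.
by rewrite tofracD tofracM mulr1.
Qed.

Lemma base_of_poly_inj : injective P.
Proof.
case: b => p r; first by rewrite !val_base_of_poly_poly.
by move/(congr1 (@laurent_val k)); rewrite !val_base_of_poly_laurent => /eqP;
  rewrite tofrac_eq => /eqP.
Qed.

Lemma base_ring_domain (d e : D) : d * e = 0 -> d = 0 \/ e = 0.
Proof.
case: b d e => /= d e.
  by move/eqP; rewrite mulf_eq0 => /orP[] /eqP; [left|right].
move/(congr1 (@laurent_val k)) => /= /eqP; rewrite mulf_eq0.
by case/orP => /eqP d0; [left|right]; apply: val_inj.
Qed.

(** This treats both bases at once: questions about D become questions about polynomials after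
    multiplication by a power of [h], which is trivial for k[h]. *)
Lemma base_ring_denominator (d : D) : exists N p,
  h ^+ N * d = P p /\ (b = PolyBase -> N = 0).
Proof.
suff [N [p dp]] : exists N p, P 'X^N * d = P p /\ (b = PolyBase -> N = 0).
  by exists N, p; rewrite -base_of_polyXn.
case: b d => [d|d].
  by exists 0, d; rewrite !val_base_of_poly_poly mul1r.
case: (d) => f fP; have /asboolP[p [n fE]] := fP; exists n, p; split=> //; apply: val_inj.
rewrite -[LHS]/(laurent_val (base_of_poly LaurentBase 'X^n) * f).
rewrite -[RHS]/(laurent_val _) !val_base_of_poly_laurent tofracXn fE mulrC divfK //.
by rewrite expf_neq0 // tofrac_eq0 polyX_eq0.
Qed.

Lemma base_h_neq0 : h <> 0.
Proof.
by rewrite -base_of_polyX -(rmorph0 (horner_alg h)) => /base_of_poly_inj/eqP;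
  rewrite polyX_eq0.
Qed.
End BaseRing.

Lemma laurent_h_unit (k : fieldType) :
  exists h' : base_ring k LaurentBase, base_h k LaurentBase * h' = 1.
Proof.
have hP : (FracField.tofrac ('X : {poly k}))^-1 \in @laurent_pred k.
  by apply/asboolP; exists 1, 1; rewrite tofrac1 mul1r.
exists (Laurent hP); apply: val_inj => /=.
by rewrite divff // tofrac_eq0 polyX_eq0.
Qed.

Section PolyFacts.
Variable k : fieldType.
Implicit Types (p r : {poly k}) (c : k).

Lemma coef_comp_scale p c i : (p \Po (c *: 'X))`_i = c ^+ i * p`_i.
Proof.
rewrite comp_polyE coef_sum; under eq_bigr do rewrite exprZn !coefZ coefXn.
have [ip|pi] := ltnP i (size p).
  rewrite (bigD1 (Ordinal ip)) //= eqxx mulr1 big1 ?addr0 1?mulrC // => j.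
  by rewrite -val_eqE /= eq_sym => /negPf ->; rewrite !mulr0.
rewrite nth_default // mulr0 big1 // => j _.
by rewrite gtn_eqF ?mulr0 //; apply: leq_trans pi.
Qed.

Lemma size_comp_scale p c : c != 0 -> size (p \Po (c *: 'X)) = size p.
Proof. by move=> c0; rewrite size_comp_poly2 // size_scale ?size_polyX. Qed.

Lemma poly_of_Xn p n : (0 < n)%N -> (forall i, p`_i != 0 -> (n %| i)%N) ->
  exists p', p = p' \Po 'X^n.
Proof.
move=> n0 pn; exists (\poly_(i < size p) p`_(i * n)).
apply/polyP => i; rewrite coef_comp_poly_Xn // coef_poly.
have [ni|ni] := boolP (n %| i)%N; last first.
  by apply/eqP; apply: contraNT ni => /pn.
rewrite divnK //; case: ltnP => // pi; rewrite nth_default //.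
by apply: leq_trans pi (leq_div _ _).
Qed.

Lemma dvd_Xn p r n : p * r = 'X^n -> exists c t,
  [/\ c != 0, p = c *: 'X^t & (t <= n)%N].
Proof.
move=> pr; have : p %| ('X - 0%:P) ^+ n by rewrite subr0 -pr dvdp_mulr.
case/dvdp_exp_XsubCP => t tn; rewrite subr0 => /eqpP[[c1 c2] /= /andP[c10 c20] pX].
exists (c1^-1 * c2), t; split=> //; first by rewrite mulf_neq0 ?invr_eq0.
by rewrite -scalerA -pX scalerA mulVf ?scale1r.
Qed.

(** Nonzero constant terms force the powers of X to cancel; this makes the degree invariant under
    units of the Laurent ring. *)
Lemma scaled_Xn_size s t c p r : c != 0 -> p.[0] != 0 -> r.[0] != 0 ->
  'X^s * p = c *: ('X^t * r) -> size p = size r.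
Proof.
wlog st : s t c p r / (s <= t)%N => [wl|] c0 p0 r0 E.
  have [st|ts] := leqP s t; first exact: wl E.
  apply/esym; apply: (wl t s c^-1) => //; first exact: ltnW.
    by rewrite invr_eq0.
  by rewrite E scalerA mulVf ?scale1r.
have {}E : p = c *: ('X^(t - s) * r).
  apply: (mulfI (x := 'X^s)); first by rewrite -size_poly_eq0 size_polyXn.
  by rewrite E -scalerAr mulrA -exprD subnKC.
move: p0; rewrite E hornerZ hornerM hornerXn; case: (t - s)%N => [|u].
  by rewrite !expr0 !mul1r size_scale.
by rewrite exprS !mul0r mulr0 eqxx.
Qed.

Lemma horner_algZ (A : algType k) (u : A) c p :
  horner_alg u (c *: p) = c *: horner_alg u p.
Proof. by rewrite -mul_polyC rmorphM /= horner_algC mulr_algl. Qed.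

Lemma lrmorph_horner_alg (A B : algType k) (f : {lrmorphism A -> B}) u p :
  f (horner_alg u p) = horner_alg (f u) p.
Proof.
elim/poly_ind: p => [|p c IH]; first by rewrite !rmorph0.
by rewrite !(rmorphD, rmorphM) /= !horner_algX !horner_algC IH linearZ /= rmorph1.
Qed.

Lemma horner_alg_comp (A : algType k) (u : A) p r :
  horner_alg u (p \Po r) = horner_alg (horner_alg u r) p.
Proof.
elim/poly_ind: p => [|p c IH]; first by rewrite comp_poly0 !rmorph0.
rewrite comp_polyD comp_polyM comp_polyX comp_polyC !(rmorphD, rmorphM) /=.
by rewrite IH horner_algX !horner_algC.
Qed.

Lemma horner_alg_comp_scale (A : algType k) (u : A) p c :
  horner_alg u (p \Po (c *: 'X)) = horner_alg (c *: u) p.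
Proof. by rewrite horner_alg_comp horner_algZ horner_algX. Qed.

Lemma comp_scaleK p c : c != 0 -> p \Po (c^-1 *: 'X) \Po (c *: 'X) = p.
Proof.
move=> c0; apply/polyP => i; rewrite !coef_comp_scale mulrA -exprMn.
by rewrite divff ?expr1n ?mul1r.
Qed.
End PolyFacts.

Section BaseRingUnits.
Variables (k : fieldType) (b : base_kind).
Local Notation D := (base_ring k b).
Local Notation h := (base_h k b).
Local Notation P := (@base_of_poly k b).

Lemma base_hI N : injective (fun d : D => h ^+ N * d).
Proof.
move=> d e; elim: N => [|N IH]; first by rewrite !mul1r.
rewrite !exprS -!mulrA => /eqP; rewrite -subr_eq0 -mulrBr => /eqP/base_ring_domain.
by case=> [/base_h_neq0//|/eqP]; rewrite subr_eq0 => /eqP.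
Qed.

(** With denominators cleared, the unit and its inverse become polynomials whose product is a power
    of X, hence monomials. *)
Lemma base_ring_unit (d e : D) : d * e = 1 -> exists (c : k) s t,
  [/\ c != 0, h ^+ s * d = c *: h ^+ t & b = PolyBase -> s = 0 /\ t = 0].
Proof.
move=> de; have [N [p [pE N0]]] := base_ring_denominator d.
have [M [r [rE M0]]] := base_ring_denominator e.
have pr : p * r = 'X^(N + M).
  apply: (@base_of_poly_inj k b); rewrite base_of_polyXn.
  rewrite base_of_polyE rmorphM /= -!base_of_polyE -pE -rE.
  by rewrite mulrACA de mulr1 exprD.
have [c [t [c0 pX tNM]]] := dvd_Xn pr.
exists c, N, t; split=> // [|bP].
  by rewrite pE pX base_of_polyE horner_algZ -base_of_polyE base_of_polyXn.
by move: tNM; rewrite N0 ?M0 // leqn0 => /eqP ->.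
Qed.
End BaseRingUnits.

HB.instance Definition _ (k : fieldType) (b : base_kind) :=
  GRing.RMorphism.copy (@base_of_poly k b) (horner_alg (base_h k b)).

(** * Algebraic and transcendental elements of k(z) *)

Section RationalFunctions.
Variable k : fieldType.
Local Notation K := {fraction {poly k}}.

Definition ratC : k -> K := @FracField.tofrac {poly k} \o polyC.
HB.instance Definition _ :=
  GRing.RMorphism.copy ratC (@FracField.tofrac {poly k} \o polyC).
Definition ratX : K := FracField.tofrac 'X.

Lemma ratX_neq0 : ratX != 0.
Proof. by rewrite tofrac_eq0 polyX_eq0. Qed.

Lemma map_ratC_tofrac (p r : {poly k}) :
  (map_poly ratC p).[FracField.tofrac r] = FracField.tofrac (p \Po r).
Proof.
by rewrite map_poly_comp /= horner_map.
Qed.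

Lemma ratX_independent J (f g : nat -> k) :
    \sum_(i < J) (ratC (f i) * ratX ^+ i + ratC (g i) * ratX ^- i.+1) = 0 ->
  forall i, (i < J)%N -> f i = 0.
Proof.
move=> S0 i iJ.
(* Multiplying by X^J makes all exponents natural numbers, still distinct. *)
have : FracField.tofrac (\sum_(i < J)
    ((f i)%:P * 'X^(J + i) + (g i)%:P * 'X^(J - i.+1))) = 0.
  rewrite -[RHS](mulr0 (ratX ^+ J)) -S0 mulr_sumr rmorph_sum.
  apply: eq_bigr => l _; rewrite mulrDr rmorphD !rmorphM /= !tofracXn.
  rewrite exprD mulrCA mulrA; congr (_ + _); rewrite mulrCA; congr (_ * _).
  have -> : ratX ^+ J = ratX ^+ (J - l.+1) * ratX ^+ l.+1.
    by rewrite -exprD subnK.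
  by rewrite mulfK // expf_neq0 ?ratX_neq0.
move/eqP; rewrite tofrac_eq0 => /eqP/(congr1 (fun p : {poly k} => p`_(J + i))).
rewrite coef0 coef_sum (bigD1 (Ordinal iJ)) //= big1 ?addr0 => [|l il].
  rewrite coefD !coefCM !coefXn eqxx mulr1.
  by rewrite (_ : _ == _ = false) ?mulr0 ?addr0 //; apply/eqP; lia.
rewrite coefD !coefCM !coefXn eqn_add2l.
rewrite (_ : (i == l :> nat) = false); last by rewrite eq_sym; apply/negbTE.
by rewrite (_ : _ == _ = false) ?mulr0 ?addr0 //; apply/eqP; lia.
Qed.

Definition rat_algebraic (u : K) : Prop := algebraicOver ratC u.

Lemma rat_algebraicD u v :
  rat_algebraic u -> rat_algebraic v -> rat_algebraic (u + v).
Proof. exact: (@algebraic_add k K ratC). Qed.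
Lemma rat_algebraicM u v :
  rat_algebraic u -> rat_algebraic v -> rat_algebraic (u * v).
Proof. exact: (@algebraic_mul k K ratC). Qed.
Lemma rat_algebraicC c : rat_algebraic (ratC c).
Proof. exact: (@algebraic_id k K ratC). Qed.
Lemma rat_algebraic0 : rat_algebraic 0.
Proof. exact: (@algebraic0 k K ratC). Qed.

Lemma rat_algebraic_horner u p :
  rat_algebraic u -> rat_algebraic (map_poly ratC p).[u].
Proof.
move=> ualg; elim/poly_ind: p => [|p c IH].
  by rewrite rmorph0 horner0; apply: rat_algebraic0.
rewrite rmorphD rmorphM /= map_polyX map_polyC /= hornerMXaddC.
exact: rat_algebraicD (rat_algebraicM IH ualg) (rat_algebraicC c).
Qed.
Lemma ratXn_transcendental t : (0 < t)%N -> ~ rat_algebraic (ratX ^+ t).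
Proof.
move=> t0 [p p0]; rewrite /root -tofracXn map_ratC_tofrac tofrac_eq0 => /eqP pX.
case/eqP: p0; apply/polyP => i; rewrite coef0.
have := congr1 (fun r : {poly k} => r`_(i * t)) pX.
by rewrite /= coef_comp_poly_Xn // dvdn_mull // mulnK // coef0.
Qed.
End RationalFunctions.
Arguments ratC {k}.
Arguments ratX {k}.

(** * Homogeneous elements *)

Section Homogeneous.
Variables (k : fieldType) (D : comAlgType k) (sigma : algAut D) (a : D).
Hypothesis D_domain : forall d e : D, d * e = 0 -> d = 0 \/ e = 0.
Hypothesis a_neq0 : a <> 0.
Local Notation R := (gwa sigma a).
Local Notation base := (gwa_base sigma a).

Lemma homog0E (r : R) : homog 0 r -> exists d, r = base d.
Proof.
by case/(homogE D_domain a_neq0) => d; rewrite mulr1 => ->; exists d.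
Qed.

Lemma homog_uniq i j (r : R) : r <> 0 -> homog i r -> homog j r -> i = j.
Proof.
move=> r0 ri rj; apply/eqP; apply: contra_notT r0 => ij.
apply: (zcoef_inj D_domain a_neq0) => l; rewrite zcoef0.
by have [->|/ri//] := eqVneq l i; apply: rj.
Qed.

Lemma homogX i (r : R) t : homog i r -> homog (i *+ t) (r ^+ t).
Proof.
move=> ri; elim: t => [|t IH].
  by rewrite expr0 mulr0n -(rmorph1 base); apply: homog_base.
by rewrite exprS mulrS; case: (homogM ri IH).
Qed.

Lemma homog_baseM i d (r : R) : homog i r -> homog i (base d * r).
Proof. by move=> ri j /ri rj; rewrite zcoef_baseM rj mulr0. Qed.

Lemma homog_twist i (r s : R) d e : homog i r ->
  (base d * r) * (base e * s) = base (d * aut_expz sigma i e) * (r * s).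
Proof.
case/(homogE D_domain a_neq0) => f ->; rewrite rmorphM -!mulrA; congr (_ * _).
rewrite [zmon _ _ _ * (_ * _)]mulrA zmon_base !mulrA -!rmorphM.
by rewrite [f * _]mulrC.
Qed.
End Homogeneous.

(** * The quantum GWA and the products y^m x^m and x^m y^m *)

Section QuantumGWA.
Variables (k : fieldType) (b : base_kind) (q : k).
Hypothesis q_neq0 : q != 0.
Local Notation D := (base_ring k b).
Local Notation h := (base_h k b).
Local Notation P := (@base_of_poly k b).
Variable sigma : algAut D.
Hypothesis sigma_h : sigma h = q *: h.
Variable a : {poly k}.
Hypothesis a_size : (1 < size a)%N.
Hypothesis a0_neq0 : b = LaurentBase -> a.[0] != 0.
Local Notation R := (gwa sigma (P a)).
Local Notation base := (gwa_base sigma (P a)).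
Local Notation x := (gwa_x sigma (P a)).
Local Notation y := (gwa_y sigma (P a)).
Local Notation zmon := (zmon sigma (P a)).

Lemma base_of_polyZ c p : P (c *: p) = c *: P p.
Proof. exact: horner_algZ. Qed.

Lemma base_scale c d : base (c *: d) = c *: base d.
Proof. exact: linearZ. Qed.

Lemma base_of_poly_eq0 p : P p = 0 -> p = 0.
Proof. by rewrite -(rmorph0 P) => /base_of_poly_inj. Qed.

Lemma a_neq0 : a != 0. Proof. by rewrite -size_poly_eq0; case: size a_size. Qed.

Lemma Pa_neq0 : P a <> 0.
Proof. by move/base_of_poly_eq0/eqP; rewrite (negPf a_neq0). Qed.

Local Notation dom := (@base_ring_domain k b).

Lemma sigma_P p : sigma (P p) = P (p \Po (q *: 'X)).
Proof.
by rewrite lrmorph_horner_alg sigma_h /base_of_poly horner_alg_comp_scale.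
Qed.

Lemma sigmaV_P p : aut_inv sigma (P p) = P (p \Po (q^-1 *: 'X)).
Proof.
by apply: (can_inj (autK sigma)); rewrite autVK sigma_P comp_scaleK.
Qed.

Lemma zmon_neq0 i : zmon i <> 0.
Proof.
move/(congr1 (fun s : R => zcoef s i)); rewrite zcoef0.
exact: (zcoef_zmon_neq0 dom Pa_neq0).
Qed.

(** This is a(h) a(q^-1 h) ... a(q^(1-m) h), while [xy_poly m] is a(q h) ... a(q^m h). *)
Fixpoint yx_poly (m : nat) : {poly k} :=
  if m is m'.+1 then (yx_poly m' \Po (q^-1 *: 'X)) * a else 1.
Fixpoint xy_poly (m : nat) : {poly k} :=
  if m is m'.+1 then (xy_poly m' * a) \Po (q *: 'X) else 1.

Lemma yx_pow m : y ^+ m * x ^+ m = base (P (yx_poly m)).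
Proof.
elim: m => [|m IH] /=; first by rewrite !rmorph1 mulr1.
rewrite exprS exprSr -!mulrA [_ ^+ m * (_ * _)]mulrA IH mulrA gwa_yd -mulrA gwa_yx.
by rewrite sigmaV_P rmorphM /= -rmorphM.
Qed.

Lemma xy_pow m : x ^+ m * y ^+ m = base (P (xy_poly m)).
Proof.
elim: m => [|m IH] /=; first by rewrite !rmorph1 mulr1.
rewrite exprS exprSr -!mulrA [_ ^+ m * (_ * _)]mulrA IH mulrA gwa_xd -mulrA gwa_xy.
by rewrite -!rmorphM /= sigma_P.
Qed.

Let qV_neq0 : q^-1 != 0. Proof. by rewrite invr_eq0. Qed.

Lemma size_yx_poly m : size (yx_poly m) = (m * (size a).-1).+1.
Proof.
elim: m => [|m IH] /=; first by rewrite size_poly1.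
rewrite size_mul ?a_neq0 -?size_poly_eq0 ?size_comp_scale ?IH //.
by case: size a_size => // s _ /=; lia.
Qed.

Lemma size_xy_poly m : size (xy_poly m) = (m * (size a).-1).+1.
Proof.
elim: m => [|m IH] /=; first by rewrite size_poly1.
rewrite size_comp_scale // size_mul ?a_neq0 -?size_poly_eq0 ?IH //.
by case: size a_size => // s _ /=; lia.
Qed.

Lemma yx_poly0 m : (yx_poly m).[0] = a.[0] ^+ m.
Proof.
elim: m => [|m IH] /=; first by rewrite hornerE.
by rewrite hornerM horner_comp !hornerE IH exprSr.
Qed.

Lemma xy_poly0 m : (xy_poly m).[0] = a.[0] ^+ m.
Proof.
elim: m => [|m IH] /=; first by rewrite hornerE.
by rewrite horner_comp !hornerE IH exprSr.
Qed.

Lemma base_h_exp_neq0 N : h ^+ N <> 0.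
Proof.
rewrite -base_of_polyXn => /base_of_poly_eq0/eqP.
by rewrite -size_poly_eq0 size_polyXn.
Qed.

(** * Weights of the automorphism *)

Section Eta.
Variables (eta : {lrmorphism R -> R}) (gamma mu : k) (n m : nat).
Hypothesis ord_gamma : n.-primitive_root gamma.
Hypothesis ord_mu : m.-primitive_root mu.
Hypothesis coprime_nm : coprime n m.
Hypothesis eta_h : eta (base h) = gamma *: base h.
Hypothesis eta_y : eta y = mu *: y.
Hypothesis eta_x : eta x = mu^-1 *: x.

Lemma ord_mu_gt0 : (0 < m)%N. Proof. exact: prim_order_gt0 ord_mu. Qed.
Lemma ord_gamma_gt0 : (0 < n)%N. Proof. exact: prim_order_gt0 ord_gamma. Qed.

Lemma base_P_alg p : base (P p) = horner_alg (base h) p.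
Proof. exact: lrmorph_horner_alg. Qed.

Lemma eta_P p : eta (base (P p)) = base (P (p \Po (gamma *: 'X))).
Proof.
by rewrite !base_P_alg lrmorph_horner_alg eta_h horner_alg_comp_scale.
Qed.

Lemma eta_hX N : eta (base (h ^+ N)) = gamma ^+ N *: base (h ^+ N).
Proof. by rewrite !rmorphXn /= eta_h exprZn. Qed.

Definition zweight (i : int) : k :=
  match i with Posz t => mu^-1 ^+ t | Negz t => mu ^+ t.+1 end.

Lemma eta_zmon i : eta (zmon i) = zweight i *: zmon i.
Proof. by case: i => t; rewrite rmorphXn /= ?eta_x ?eta_y exprZn. Qed.

Lemma zweight_eq1 i : (zweight i == 1) = (m %| `|i|)%N.
Proof.
case: i => t /=; last by rewrite (prim_order_dvd ord_mu).
by rewrite exprVn invr_eq1 (prim_order_dvd ord_mu).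
Qed.

(** The [n]th power kills gamma, so mu^(n i) = 1, and coprimality gives m | i. In particular h^u z^i
    is fixed only if both factors are. *)
Lemma weight_coprime i u v : zweight i * gamma ^+ u = gamma ^+ v ->
  (m %| `|i|)%N /\ gamma ^+ u = gamma ^+ v.
Proof.
move=> E; have gn t : (gamma ^+ t) ^+ n = 1.
  by rewrite exprAC (prim_expr_order ord_gamma) expr1n.
have wn : zweight i ^+ n = 1.
  by move: (congr1 (fun c => c ^+ n) E); rewrite /= exprMn !gn mulr1.
have mi : (m %| `|i|)%N.
  rewrite -(@Gauss_dvdl _ _ n) 1?coprime_sym //.
  case: i wn {E} => t /= /eqP; rewrite -exprM.
    by rewrite exprVn invr_eq1 (prim_order_dvd ord_mu).
  by rewrite (prim_order_dvd ord_mu).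
split=> //; move: mi E; rewrite -zweight_eq1 => /eqP ->.
by rewrite mul1r.
Qed.

(** With denominators cleared, [r] becomes p(h) z^i, an eigenvector for gamma^N; its leading
    coefficient gives an equation for [weight_coprime]. *)
Lemma fixed_homog i (r : R) : r <> 0 -> homog i r -> eta r = r -> (m %| `|i|)%N.
Proof.
move=> r0 /(homogE dom Pa_neq0)[d rd] etar.
have [N [p [pE _]]] := base_ring_denominator d.
have p0 : p != 0.
  apply/eqP => p0; move: pE; rewrite p0 rmorph0 => /dom[/base_h_exp_neq0//|d0].
  by apply: r0; rewrite rd d0 rmorph0 mul0r.
have hr : base (P p) * zmon i = base (h ^+ N) * r.
  by rewrite -pE rmorphM -mulrA -rd.
have : eta (base (P p) * zmon i) = gamma ^+ N *: (base (P p) * zmon i).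
  by rewrite hr rmorphM /= eta_hX etar scalerAl.
rewrite rmorphM /= eta_P eta_zmon -scalerAr !scalerAl -!base_scale -!base_of_polyZ.
move/eqP; rewrite -subr_eq0 -mulrBl -!rmorphB /= => /eqP.
move/(congr1 (fun s : R => zcoef s i)); rewrite zcoef0.
move/(zcoef_mon_eq0 dom Pa_neq0).
move/base_of_poly_eq0/eqP; rewrite subr_eq0 => /eqP pp.
have := congr1 (fun p' : {poly k} => p'`_(size p).-1) pp.
rewrite !coefZ coef_comp_scale mulrA => /mulIf E.
by have [] := weight_coprime (E _); rewrite // -lead_coefE lead_coef_eq0.
Qed.
Section Theta.
Variable theta : {lrmorphism R -> R}.
Hypothesis theta_inj : injective theta.
Hypothesis theta_fixed : forall r, eta (theta r) = theta r.
Hypothesis theta_surj : forall s, eta s = s -> exists r, theta r = s.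

Lemma theta_neq0 r : r <> 0 -> theta r <> 0.
Proof. by move=> r0; rewrite -(rmorph0 theta) => /theta_inj. Qed.

(** * Comparing degrees when theta(h) lies in the base *)

Section DegreeCount.
Variable d : D.
Hypothesis theta_h : theta (base h) = base d.

Lemma theta_P p : theta (base (P p)) = base (horner_alg d p).
Proof. by rewrite base_P_alg lrmorph_horner_alg theta_h -lrmorph_horner_alg. Qed.

Lemma d_neq0 : d <> 0.
Proof.
move=> d0; apply: (@base_h_neq0 k b); apply: (@base_inj _ _ sigma (P a)).
by apply: theta_inj; rewrite theta_h d0 !rmorph0.
Qed.

Lemma baseX_neq0 N : base (d ^+ N) <> 0.
Proof.
rewrite -(rmorph0 base) => /base_inj; elim: N => [|N IH].
  by apply/eqP/oner_neq0.
by rewrite exprS => /dom[/d_neq0|].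
Qed.

(** A power of [h] times [e] is a polynomial in [h], so theta(e) is a factor of an element of degree
    0 whose other factor, a power of [d], has degree 0. *)
Lemma theta_base e : exists e', theta (base e) = base e'.
Proof.
have [->|e0] := pselect (e = 0); first by exists 0; rewrite !rmorph0.
have [N [p [pE _]]] := base_ring_denominator e.
have te0 : theta (base e) <> 0.
  by apply: theta_neq0; rewrite -(rmorph0 base) => /base_inj.
have E : base (d ^+ N) * theta (base e) = base (horner_alg d p).
  by rewrite -theta_P -pE !rmorphM /= !rmorphXn /= theta_h.
have [i [hi he]] : exists i,
    homog i (base (d ^+ N)) /\ homog (- i) (theta (base e)).
  apply: (homog_factors dom Pa_neq0); first by rewrite E; apply: homog_base.
  by case/(gwa_domain dom Pa_neq0) => [/baseX_neq0|].
have i0 : i = 0.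
  exact: (homog_uniq dom Pa_neq0 (@baseX_neq0 N) hi (@homog_base _ _ _ _ _)).
by apply: (homog0E dom Pa_neq0); rewrite i0 oppr0 in he.
Qed.

(** theta(y) theta(x) = a(theta(h)) is nonzero of degree 0, so its factors are homogeneous of
    opposite degrees. *)
Lemma theta_xy_homog : exists j,
  [/\ homog j (theta x), homog (- j) (theta y) & (m %| `|j|)%N].
Proof.
have x0 : x <> 0 := @zmon_neq0 1.
have y0 : y <> 0 := @zmon_neq0 (Negz 0).
have wv : theta y * theta x = base (horner_alg d a).
  by rewrite -rmorphM gwa_yx /= theta_P.
have [i [hy hx]] : exists i, homog i (theta y) /\ homog (- i) (theta x).
  apply: (homog_factors dom Pa_neq0); first by rewrite wv; apply: homog_base.
  by case/(gwa_domain dom Pa_neq0); apply: theta_neq0.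
exists (- i); rewrite opprK; split=> //.
by apply: fixed_homog hx _; [apply: theta_neq0 | apply: theta_fixed].
Qed.

Lemma theta_zmon_homog j l : homog j (theta x) -> homog (- j) (theta y) ->
  homog (l * j) (theta (zmon l)).
Proof.
move=> jx jy; case: l => t; rewrite rmorphXn /=.
  have -> : Posz t * j = j *+ t by rewrite pmulrn mulrzz mulrC.
  exact: homogX.
have -> : Negz t * j = (- j) *+ t.+1 by rewrite pmulrn mulrzz NegzE !mulNr mulrC.
exact: homogX.
Qed.

(** In the expansion of a preimage of z^i, the term of index l has an image of degree l j; as j is
    nonzero, only one l reaches degree i. *)
Lemma zmon_multiple j i : homog j (theta x) -> homog (- j) (theta y) ->
    i <> 0 -> eta (zmon i) = zmon i ->
  exists l e, l * j = i /\ zmon i = base e * theta (zmon l).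
Proof.
move=> jx jy i0 /theta_surj[r rE].
have [f [J0 rJ]] := gwa_normal_form r.
have [g gE] := choice (fun l => theta_base (f l)).
have zE J : (J0 <= J)%N ->
    zmon i = int_sum J (fun l => base (g l) * theta (zmon l)).
  move=> J0J; rewrite -rE {1}(rJ J J0J) int_sum_rmorph; apply: int_sum_eq => l /=.
  by rewrite rmorphM /= gE.
have gh l : homog (l * j) (base (g l) * theta (zmon l)).
  exact/homog_baseM/theta_zmon_homog.
pose J := maxn J0 `|i|.+1; have [J0J iJ] : (J0 <= J)%N /\ (`|i| < J)%N.
  by rewrite leq_maxl leq_max ltnSn orbT.
have [l lE] : exists l, zcoef (base (g l) * theta (zmon l)) i <> 0.
  apply: (int_sum_exists (J := J)); rewrite -zcoef_int_sum -zE //.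
  exact: (zcoef_zmon_neq0 dom Pa_neq0).
have li : l * j = i by apply/eqP; apply: contra_notT lE; rewrite eq_sym => /gh.
have j0 : j <> 0 by move=> j0; apply: i0; rewrite -li j0 mulr0.
exists l, (g l); split=> //; apply: (zcoef_inj dom Pa_neq0) => i'.
have [->|ii'] := eqVneq i' i; last first.
  by rewrite zcoef_zmon_neq // gh // li.
rewrite (zE J) // zcoef_int_sum (int_sum_only (l := l)) //.
  by move: li j0 iJ; nia.
move=> l' l'l; apply: gh; rewrite -li; apply: contra l'l => /eqP/mulIf E.
by rewrite E //; apply/eqP.
Qed.

(** x^m and y^m are base multiples of images of monomials, which forces |j| = m and l = 1 or -1. So
    theta(x), theta(y) and x^m, y^m, possibly exchanged, are base multiples of each other, and so
    are their products. *)
Lemma theta_mutual_multiple : exists A f f',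
  [/\ A = yx_poly m \/ A = xy_poly m, P A = f * horner_alg d a
    & horner_alg d a = f' * P A].
Proof.
have [j [jx jy mj]] := theta_xy_homog.
have wv : theta y * theta x = base (horner_alg d a).
  by rewrite -rmorphM gwa_yx /= theta_P.
have fz i : (m %| `|i|)%N -> eta (zmon i) = zmon i.
  by rewrite -zweight_eq1 eta_zmon => /eqP ->; rewrite scale1r.
have m0 := ord_mu_gt0; have mi : (m : int) <> 0 by lia.
have mNi : - (m : int) <> 0 by lia.
have [l [e [lj zmE]]] := zmon_multiple jx jy mi (fz (Posz m) (dvdnn m)).
have [l' [e' [l'j zNmE]]] : exists l e, l * j = - (m : int) /\
    zmon (- (m : int)) = base e * theta (zmon l).
  by apply: (zmon_multiple jx jy mNi); apply: fz; rewrite abszN.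
have jm : `|j|%N = m.
  apply/eqP; rewrite eqn_dvd mj andbT; apply/dvdnP; exists `|l|%N.
  by rewrite -abszM lj.
have yE : zmon (- (m : int)) = y ^+ m.
  by rewrite (_ : - (m : int) = Negz m.-1) ?/zmon ?prednK //; move: m0; lia.
have twist i (w1 w2 s1 s2 : R) e1 e2 : homog i w1 -> s1 = base e1 * w1 ->
    s2 = base e2 * w2 -> exists f, s1 * s2 = base f * (w1 * w2).
  by move=> wi -> ->; rewrite (homog_twist dom Pa_neq0 _ _ _ wi); eexists.
have homog_of i (w : R) : homog i w -> exists g, w = base g * zmon i.
  exact: (homogE dom Pa_neq0).
have hz i : homog i (zmon i) by move=> i'; apply: zcoef_zmon_neq.
have baseP A s : s = base (P A) -> (exists f, s = base f * (theta y * theta x)) ->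
    (exists f, theta y * theta x = base f * s) ->
    exists f f', P A = f * horner_alg d a /\ horner_alg d a = f' * P A.
  move=> -> [f fE] [f' f'E]; exists f, f'.
  by split; apply: (@base_inj _ _ sigma (P a)); rewrite rmorphM /= -wv.
have hx : homog (m : int) (x ^+ m) by apply: (hz (Posz m)).
have hy : homog (- (m : int)) (y ^+ m) by rewrite -yE; apply: hz.
(* The sign of j tells whether [theta] preserves or exchanges x and y. *)
have [jE|jE] : j = m \/ j = - (m : int) by move: jm; lia.
  have l1 : l = 1 by move: lj m0; rewrite jE; nia.
  have l'1 : l' = -1 by move: l'j m0; rewrite jE; nia.
  rewrite l1 in zmE; rewrite l'1 yE in zNmE; rewrite jE in jx jy.
  have [g gE] := homog_of _ _ jx; have [g' g'E] := homog_of _ _ jy.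
  rewrite yE in g'E; exists (yx_poly m).
  have [f [f' [E1 E2]]] := baseP (yx_poly m) (y ^+ m * x ^+ m) (yx_pow m)
    (twist _ _ _ _ _ _ _ jy zNmE zmE) (twist _ _ _ _ _ _ _ hy g'E gE).
  by exists f, f'; split=> //; left.
have l1 : l = -1 by move: lj m0; rewrite jE; nia.
have l'1 : l' = 1 by move: l'j m0; rewrite jE; nia.
rewrite l1 in zmE; rewrite l'1 yE in zNmE; rewrite jE ?opprK in jx jy.
have [g gE] := homog_of _ _ jx; have [g' g'E] := homog_of _ _ jy.
rewrite yE in gE; exists (xy_poly m).
have [f [f' [E1 E2]]] := baseP (xy_poly m) (x ^+ m * y ^+ m) (xy_pow m)
  (twist _ _ _ _ _ _ _ jy zmE zNmE) (twist _ _ _ _ _ _ _ hx g'E gE).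
by exists f, f'; split=> //; right.
Qed.

(** Mutual multiples differ by a unit, that is, by a scalar and a power of h. Up to such a factor
    a(theta(h)) has degree n deg(a), and y^m x^m or x^m y^m has degree m deg(a). *)
Lemma degree_count (c : k) : c != 0 ->
  d = c *: h ^+ n \/ b = LaurentBase /\ h ^+ n * d = c%:A -> n = m.
Proof.
move=> c0 dE; have [A [f [f' [AE fE f'E]]]] := theta_mutual_multiple.
have sA : size A = (m * (size a).-1).+1.
  by case: AE => ->; rewrite ?size_yx_poly ?size_xy_poly.
have A0 : A.[0] = a.[0] ^+ m by case: AE => ->; rewrite ?yx_poly0 ?xy_poly0.
have n0 := ord_gamma_gt0.
have ff : f * f' = 1.
  have /dom[] : (f * f' - 1) * P A = 0.
      by rewrite mulrBl mul1r -mulrA -f'E -fE subrr.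
    by move/eqP; rewrite subr_eq0 => /eqP.
  by move/base_of_poly_eq0 => A00; move: sA; rewrite A00 size_poly0.
(* [B] is a(d) with its denominator cleared. *)
have [B [s' [sB BE B0 s'0]]] : exists (B : {poly k}) s',
    [/\ size B = (n * (size a).-1).+1, h ^+ s' * horner_alg d a = P B,
        b = LaurentBase -> B.[0] != 0 & b = PolyBase -> s' = 0].
  have size_comp (r s : {poly k}) : size r = size a -> size s = n.+1 ->
      size (r \Po s) = (n * (size a).-1).+1.
    move=> sr ss; have := size_comp_poly r s; rewrite sr ss /= mulnC.
    case: (size (r \Po s)) => [|u <- //] /= /esym/eqP; rewrite muln_eq0.
    by move: a_size n0; case: n (size a) => [|?] [|[|?]].
  have h0Xn : ('X^n : {poly k}).[0] = 0.
    by rewrite hornerXn expr0n (gtn_eqF n0).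
  case: dE => [->|[bL hd]].
    exists (a \Po (c *: 'X^n)), 0; split=> //.
    - by rewrite size_comp // size_scale // size_polyXn.
    - rewrite mul1r [P _]horner_alg_comp; congr (horner_alg _ a).
      by rewrite horner_algZ -base_of_polyXn.
    - by rewrite horner_comp hornerZ h0Xn mulr0.
  (* For d = c h^-n, multiplying a(d) by h^(n N) gives a reversed polynomial in h^n; it keeps its
     degree because a(0) is nonzero. *)
  set N := (size a).-1; have sN : size a = N.+1 by rewrite prednK // ltnW.
  pose a' := \poly_(i < N.+1) (a`_(N - i) * c ^+ (N - i)).
  have a'0 : b = LaurentBase -> a'.[0] != 0.
    by move=> _; rewrite horner_coef0 coef_poly subn0 mulf_neq0 ?expf_neq0 //
      -lead_coefE lead_coef_eq0 a_neq0.
  exists (a' \Po 'X^n), (n * N)%N; split; last by rewrite bL.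
  - rewrite size_comp ?size_polyXn // size_poly_eq // subnn mulr1.
    by rewrite -horner_coef0; apply: a0_neq0.
  - rewrite [P _]horner_alg_comp -base_of_polyE base_of_polyXn.
    have aE : a = \poly_(i < N.+1) a`_i by rewrite -sN coefK.
    rewrite /a' poly_def {1}aE poly_def !raddf_sum mulr_sumr /=.
    rewrite [RHS](reindex_inj rev_ord_inj); apply: eq_bigr => i _.
    have iN : (i <= N)%N by rewrite -ltnS.
    rewrite !horner_algZ !rmorphXn /= !horner_algX subSS subKn //.
    rewrite -scalerAr -scalerA; congr (_ *: _).
    rewrite -{1}(subnK iN) mulnDr exprD -mulrA [h ^+ (n * i)]exprM -exprMn hd.
    by rewrite exprM exprZn expr1n -scalerAr mulr1.
  - by move=> bL'; rewrite horner_comp h0Xn a'0.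
have [c' [s [t [c'0 fst st0]]]] := base_ring_unit ff.
have E : 'X^(s' + s) * A = c' *: ('X^t * B).
  apply: (@base_of_poly_inj k b); rewrite base_of_polyZ !rmorphM /= !base_of_polyXn.
  by rewrite fE addnC exprD mulrACA fst BE -scalerAl.
have sAB : size A = size B.
  have [bL|bP] : b = LaurentBase \/ b = PolyBase by case: b; [right|left].
    apply: scaled_Xn_size c'0 _ _ E; last exact: B0.
    by rewrite A0 expf_neq0 // a0_neq0.
  have [s0 t0] := st0 bP; move: E; rewrite s'0 // s0 t0 !mul1r => ->.
  by rewrite size_scale.
move: sAB; rewrite sA sB => -[]; case: size a_size => // sz.
by rewrite /= ltnS => sz0 /eqP; rewrite eqn_pmul2r // => /eqP.
Qed.
End DegreeCount.

(** * theta(h) in the Laurent case *)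

Lemma Pa_not_unit e : P a * e <> 1.
Proof.
move=> /base_ring_unit[c [s [t [c0 st st0]]]].
have E : 'X^s * a = c *: ('X^t * 1).
  apply: (@base_of_poly_inj k b); rewrite base_of_polyZ !rmorphM /=.
  by rewrite rmorph1 mulr1 !base_of_polyXn.
suff : size a = 1 by move: a_size => /[swap] ->.
have [bL|bP] : b = LaurentBase \/ b = PolyBase by case: b; [right|left].
  rewrite -[RHS](size_poly1 k); apply: scaled_Xn_size c0 _ _ E; first exact: a0_neq0.
  by rewrite hornerE oner_neq0.
have [s0 t0] := st0 bP; move: E; rewrite s0 t0 !mul1r => ->.
by rewrite size_scale // size_poly1.
Qed.

Lemma eta_fixed_hn : eta (base (h ^+ n)) = base (h ^+ n).
Proof. by rewrite eta_hX (prim_expr_order ord_gamma) scale1r. Qed.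

(** Units of [R] are scalar multiples of powers of h. So theta(h) = c h^s and the preimage of h^n is
    c1 h^t, whence s t = n; since theta(h) is fixed, n | s, and s is n or -n. Here s and t are the
    differences j - i and j' - i'. *)
Lemma theta_h_laurent : b = LaurentBase -> exists d (c : k), [/\ c != 0,
  theta (base h) = base d & d = c *: h ^+ n \/ h ^+ n * d = c%:A].
Proof.
move=> bL; have [h' hh'] : exists h' : D, h * h' = 1.
  by move: bL => ->; apply: laurent_h_unit.
have unit_of (r s : R) : r * s = 1 -> exists d (c : k) s t, [/\ r = base d, c != 0
    & h ^+ s * d = c *: h ^+ t].
  case/(gwa_unit dom Pa_neq0) => [|d [e [-> _ /base_ring_unit]]].
    exact: Pa_not_unit.
  by case=> c [s' [t [c0 E _]]]; exists d, c, s', t.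
have [d [c [i [j [dE c0 hd]]]]] : exists d (c : k) i j, [/\ theta (base h) = base d,
    c != 0 & h ^+ i * d = c *: h ^+ j].
  by apply: (unit_of _ (theta (base h'))); rewrite -!rmorphM hh' !rmorph1.
have hn' : h ^+ n * h' ^+ n = 1 by rewrite -exprMn hh' expr1n.
have [U UE] := theta_surj eta_fixed_hn.
have [U' U'E] : exists U', theta U' = base (h' ^+ n).
  apply: theta_surj; rewrite -[LHS]mulr1 -(rmorph1 base) -hn' rmorphM mulrA /=.
  rewrite -{1}eta_fixed_hn -rmorphM -rmorphM [_ * h ^+ n]mulrC hn' !rmorph1.
  by rewrite mul1r.
have [e [c1 [i' [j' [UeE c10 he]]]]] : exists e (c : k) i j, [/\ U = base e,
    c != 0 & h ^+ i * e = c *: h ^+ j].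
  apply: (unit_of _ U'); apply: theta_inj.
  by rewrite rmorphM /= UE U'E -rmorphM hn' !rmorph1.
have E1 : d ^+ i' * h ^+ n = c1 *: d ^+ j'.
  have := congr1 (fun d0 => theta (base d0)) he; rewrite /= base_scale linearZ /=.
  rewrite rmorphM rmorphM /= -UeE UE !rmorphXn /= !dE -!rmorphXn -rmorphM /=.
  by rewrite -base_scale => /base_inj.
have E2 : c ^+ i' *: h ^+ (i * j' + j * i' + n)
    = (c1 * c ^+ j') *: h ^+ (i * i' + j * j').
  have : h ^+ (i * j') * (h ^+ i * d) ^+ i' * h ^+ n
      = h ^+ (i * i') * (c1 *: (h ^+ i * d) ^+ j').
    rewrite !exprMn -!exprM [h ^+ (i * j') * _]mulrCA -!mulrA E1.
    by rewrite -!scalerAr.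
  rewrite hd !exprZn -scalerAr -scalerAl -!exprM -!exprD.
  by rewrite scalerA -scalerAr -exprD.
have jE : (i * j' + j * i' + n = i * i' + j * j')%N.
  have : c ^+ i' *: 'X^(i * j' + j * i' + n)
      = (c1 * c ^+ j') *: 'X^(i * i' + j * j') :> {poly k}.
    by apply: (@base_of_poly_inj k b); rewrite !base_of_polyZ !base_of_polyXn.
  move/(congr1 (fun p : {poly k} => size p)).
  by rewrite !size_scale ?mulf_neq0 ?expf_neq0 // !size_polyXn => -[].
have ij : (i = j %[mod n])%N.
  apply/eqP; rewrite -(eq_prim_root_expr ord_gamma); apply/eqP.
  have : eta (base (h ^+ i * d)) = gamma ^+ i *: base (h ^+ i * d).
    by rewrite rmorphM /= rmorphM /= eta_hX -dE theta_fixed scalerAl.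
  rewrite hd base_scale linearZ /= eta_hX !scalerA -!base_scale.
  move/base_inj; rewrite -base_of_polyXn -!base_of_polyZ => /base_of_poly_inj.
  move/(congr1 (fun p : {poly k} => p`_j)); rewrite !coefZ coefXn eqxx !mulr1.
  by rewrite mulrC => /(mulIf c0).
exists d, c; split=> //.
have [ji|ji] : j = (i + n)%N \/ i = (j + n)%N.
  (* If j1 - i1 = t n, the relation reads t (j2 - i2) = 1, so t = 1. *)
  have step (i1 j1 i2 j2 : nat) : (i1 <= j1)%N -> (i1 = j1 %[mod n])%N ->
      (i1 * j2 + j1 * i2 + n = i1 * i2 + j1 * j2)%N -> j1 = (i1 + n)%N.
    move=> le /eqP; rewrite eq_sym (eqn_mod_dvd _ le) => /dvdnP[t tE] E0.
    have t1 : (t %| 1)%N.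
      rewrite -(dvdn_addr (m := t * i2)) ?dvdn_mulr //.
      suff -> : (t * i2 + 1 = t * j2)%N by rewrite dvdn_mulr.
      by move: ord_gamma_gt0; nia.
    by move: t1 tE; rewrite dvdn1 => /eqP ->; lia.
  have [le|/ltnW le] := leqP i j; first by left; apply: step le ij jE.
  by right; apply: (step j i j' i') => //; lia.
- left; apply: (@base_hI k b i); rewrite hd ji exprD.
  by rewrite -scalerAr.
- right; apply: (@base_hI k b j); rewrite mulrA -exprD -ji hd.
  by rewrite -scalerAr mulr1.
Qed.

(** * theta(h) in the polynomial case *)

Section PolyCase.
Hypothesis bP : b = PolyBase.
Hypothesis q_neq1 : q != 1.
Local Notation K := {fraction {poly k}}.
Local Notation alg := (@rat_algebraic k).

Lemma base_of_poly_surj (d : D) : exists p, d = P p.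
Proof.
have [N [p [pE N0]]] := base_ring_denominator d.
by exists p; rewrite -pE (N0 bP) mul1r.
Qed.

Lemma eval0_exists : exists f : {rmorphism D -> K}, forall p, f (P p) = ratC p.[0].
Proof.
rewrite bP; exists (ratC \o horner_eval 0) => p.
by rewrite val_base_of_poly_poly.
Qed.

(* The two ways of making [h] vanish: their common kernel is [h R], whether   *)
(* or not [a(0) = 0].                                                         *)
Lemma at_h0_exists : exists psi1 psi2 : {rmorphism R -> K},
  [/\ forall p, psi1 (base (P p)) = ratC p.[0],
      psi1 x = ratX /\ psi1 y = ratC a.[0] / ratX,
      forall p, psi2 (base (P p)) = ratC p.[0]
    & psi2 x = ratC a.[0] / ratX /\ psi2 y = ratX].
Proof.
have [f fP] := eval0_exists.
have f_sigma d : f (sigma d) = f d.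
  have [p ->] := base_of_poly_surj d.
  by rewrite sigma_P !fP horner_comp !hornerE.
have f_sigmaV d : f (aut_inv sigma d) = f d by rewrite -f_sigma autVK.
have X0 := (ratX_neq0 k).
have [||||psi1 [psi1d psi1x psi1y]] := @gwa_lift_exists _ _ sigma (P a) K f
  ratX (ratC a.[0] / ratX).
- by move=> d; rewrite f_sigma mulrC.
- by move=> d; rewrite f_sigmaV mulrC.
- by rewrite fP divfK.
- by rewrite f_sigma fP mulrC divfK.
have [||||psi2 [psi2d psi2x psi2y]] := @gwa_lift_exists _ _ sigma (P a) K f
  (ratC a.[0] / ratX) ratX.
- by move=> d; rewrite f_sigma mulrC.
- by move=> d; rewrite f_sigmaV mulrC.
- by rewrite fP mulrC divfK.
- by rewrite f_sigma fP divfK.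
by exists psi1, psi2; split=> // p; rewrite ?psi1d ?psi2d fP.
Qed.

Variables psi1 psi2 : {rmorphism R -> K}.
Hypothesis psi1P : forall p, psi1 (base (P p)) = ratC p.[0].
Hypothesis psi1x : psi1 x = ratX.
Hypothesis psi1y : psi1 y = ratC a.[0] / ratX.
Hypothesis psi2P : forall p, psi2 (base (P p)) = ratC p.[0].
Hypothesis psi2x : psi2 x = ratC a.[0] / ratX.
Hypothesis psi2y : psi2 y = ratX.

(** [psi1] multiplies the terms in powers of y by powers of a(0), which may vanish, so it controls
    only the powers of x; [psi2] controls the powers of y. *)
Lemma at_h0_kernel (p : int -> {poly k}) J :
    let r := int_sum J (fun l => base (P (p l)) * zmon l) in
    psi1 r = 0 -> psi2 r = 0 ->
  forall i, (i < J)%N -> (p (Posz i)).[0] = 0 /\ (p (Negz i)).[0] = 0.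
Proof.
move=> r r1 r2 i iJ; split.
  pose g t := (p (Negz t)).[0] * a.[0] ^+ t.+1.
  apply: (ratX_independent (J := J) (f := fun t => (p (Posz t)).[0]) (g := g)) iJ.
  rewrite -[RHS]r1 int_sum_rmorph; apply: eq_bigr => l _ /=.
  rewrite !rmorphM /= !psi1P !rmorphXn /= psi1x psi1y expr_div_n.
  by rewrite mulrA.
pose g t := (p (Posz t)).[0] * a.[0] ^+ t.
apply: (ratX_independent (J := J) (f := fun t => (p (Negz t)).[0]) (g := g)) iJ.
(* Dividing by X matches the shift in [Negz t]: y^(t+1) goes to X^t, and x^t to a multiple of
   X^-(t+1). *)
transitivity (psi2 r / ratX); last by rewrite r2 mul0r.
rewrite int_sum_rmorph mulr_suml.
apply: eq_bigr => l _ /=.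
rewrite !rmorphM /= !psi2P !rmorphXn /= psi2x psi2y expr_div_n.
rewrite mulrDl addrC; congr (_ + _).
  by rewrite -!mulrA exprSr invfM.
by rewrite exprSr -!mulrA divff ?mulr1 ?ratX_neq0.
Qed.

Section Algebraic.
Variable psi : {rmorphism R -> K}.
Hypothesis psiC : forall c : k, psi c%:A = ratC c.

Lemma psi_horner_alg (r : R) p : psi (horner_alg r p) = (map_poly ratC p).[psi r].
Proof.
elim/poly_ind: p => [|p c IH]; first by rewrite !rmorph0 horner0.
rewrite !rmorphD !rmorphM /= map_polyX map_polyC /= horner_algX horner_algC.
by rewrite !hornerE -IH psiC.
Qed.

(* In a commutative domain, [v u = c u v] with [c != 1] and [u != 0] forces   *)
(* [v = 0]; then [a(u) = w v = 0] makes [u] algebraic.                        *)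
Lemma algebraic_of_qcomm (U V W : R) (A : {poly k}) (c : k) :
    c != 1 -> c != 0 -> A != 0 -> V * U = c *: (U * V) ->
    U * W = c *: (W * U) ->
    W * V = horner_alg U A -> psi U <> 0 ->
  [/\ alg (psi U), psi V = 0 & psi W = 0].
Proof.
move=> c1 c0 A0 VU UW WV U0.
have kill (v : K) : v * psi U = ratC c * (psi U * v) -> v = 0.
  move=> E; apply/eqP; move/eqP: U0 => U0.
  have : (ratC c - 1) * (psi U * v) == 0.
    by rewrite mulrBl mul1r -E mulrC subrr.
  rewrite !mulf_eq0 (negPf U0) /= subr_eq0 -(rmorph1 (@ratC k)).
  by rewrite (inj_eq (fmorph_inj _)) (negPf c1).
have psiZ r s : psi (c *: (r * s)) = ratC c * (psi r * psi s).
  by rewrite -[c *: _]mulr_algl rmorphM psiC rmorphM.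
have V0 : psi V = 0.
  by apply: kill; have := congr1 psi VU; rewrite psiZ rmorphM.
have W0 : psi W = 0.
  apply: kill; have := congr1 psi UW; rewrite psiZ rmorphM.
  by rewrite mulrC [psi W * _]mulrC.
split=> //; exists A => //; rewrite /root -psi_horner_alg -WV rmorphM.
by rewrite V0 mulr0.
Qed.
End Algebraic.

Lemma base_C c : base (P c%:P) = c%:A.
Proof. by rewrite base_of_polyC base_scale rmorph1. Qed.

Lemma x_h : x * base h = q *: (base h * x).
Proof. by rewrite gwa_xd sigma_h base_scale scalerAl. Qed.

Lemma h_y : base h * y = q *: (y * base h).
Proof.
rewrite gwa_yd -base_of_polyX sigmaV_P comp_polyX base_of_polyZ base_scale.
by rewrite -scalerAl scalerA divff ?scale1r.
Qed.

(** Otherwise the composite of [psi] and [theta] kills x and y and takes algebraic values only,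
    while it reaches the transcendental psi(z), z being in the image of [theta]. *)
Lemma at_h0_theta_h (psi : {rmorphism R -> K}) z :
    (forall c : k, psi c%:A = ratC c) -> eta z = z -> psi z = ratX ^+ m ->
  psi (theta (base h)) = 0.
Proof.
move=> psiC /theta_surj[r <-] rX; apply: contrapT => U0.
pose chi : {rmorphism R -> K} := psi \o theta.
have chiC c : chi c%:A = ratC c by rewrite /= linearZ /= rmorph1 psiC.
have [|U_alg V0 W0] := @algebraic_of_qcomm chi chiC (base h) x y a q q_neq1
    q_neq0 a_neq0 x_h h_y _ U0.
  by rewrite gwa_yx base_P_alg.
have chi_alg s : alg (chi s).
  elim/gwa_ind: s => [d| | |s s' IH IH'|s s' IH IH'].
  - have [p ->] := base_of_poly_surj d.
    rewrite base_P_alg (psi_horner_alg chiC).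
    exact: rat_algebraic_horner.
  - by rewrite V0; apply: rat_algebraic0.
  - by rewrite W0; apply: rat_algebraic0.
  - by rewrite rmorphD; apply: rat_algebraicD.
  - by rewrite rmorphM; apply: rat_algebraicM.
have := chi_alg r; rewrite /= rX; apply: ratXn_transcendental; exact: ord_mu_gt0.
Qed.

(** By uniqueness of normal forms, every term of [r] is fixed, and [weight_coprime] restricts its
    exponents. *)
Lemma fixed_normal_form r : eta r = r ->
  exists (p : int -> {poly k}) J0, (forall l, p l = 0 \/ (m %| `|l|)%N) /\
    forall J, (J0 <= J)%N ->
      r = int_sum J (fun l => base (P (p l \Po 'X^n)) * zmon l).
Proof.
move=> etar; have [d [J0 rd]] := gwa_normal_form r.
have [s ds] := choice (fun l => base_of_poly_surj (d l)).
have s_eigen l : zweight l *: (s l \Po (gamma *: 'X)) = s l.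
  apply/eqP; rewrite -subr_eq0; apply/eqP/base_of_poly_eq0.
  apply: (normal_form_eq0 (sigma := sigma) dom Pa_neq0 (J0 := J0)
    (d := fun l => P (zweight l *: (s l \Po (gamma *: 'X)) - s l))) => J J0J.
  rewrite -[RHS](subrr r) -{1}etar {1}(rd J J0J) {1}(rd J J0J) int_sum_rmorph.
  rewrite int_sumB; apply: int_sum_eq => l' /=.
  rewrite rmorphB /= rmorphB /= mulrBl -ds; congr (_ - _).
  rewrite rmorphM /= ds eta_P eta_zmon base_of_polyZ base_scale.
  by rewrite -scalerAr scalerAl.
have s_supp l i : (s l)`_i != 0 -> (m %| `|l|)%N /\ (n %| i)%N.
  move=> si0; have := congr1 (fun p : {poly k} => p`_i) (s_eigen l).
  rewrite coefZ coef_comp_scale mulrA -[RHS]mul1r => /(mulIf si0).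
  rewrite -[RHS](expr0 gamma) => /weight_coprime[ml /eqP].
  by rewrite -(prim_order_dvd ord_gamma).
have pex l : exists p, s l = p \Po 'X^n /\ (p = 0 \/ (m %| `|l|)%N).
  have [->|sl0] := eqVneq (s l) 0.
    by exists 0; rewrite comp_poly0; split; [|left].
  have [|p sp] := @poly_of_Xn k (s l) n ord_gamma_gt0.
    by move=> i /s_supp[].
  exists p; split=> //; right.
  by have [] := s_supp l (size (s l)).-1; rewrite // -lead_coefE lead_coef_eq0.
have [p pP] := choice pex; exists p, J0; split=> [l|J J0J]; first by case: (pP l).
by rewrite {1}(rd J J0J); apply: int_sum_eq => l; rewrite ds; case: (pP l) => <-.
Qed.

Lemma eta_xm : eta (x ^+ m) = x ^+ m.
Proof.
by rewrite rmorphXn /= eta_x exprZn exprVn (prim_expr_order ord_mu) invr1 scale1r.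
Qed.

Lemma eta_ym : eta (y ^+ m) = y ^+ m.
Proof. by rewrite rmorphXn /= eta_y exprZn (prim_expr_order ord_mu) scale1r. Qed.

Lemma base_Xn p : base (P (p \Po 'X^n)) = horner_alg (base (h ^+ n)) p.
Proof.
rewrite base_P_alg horner_alg_comp rmorphXn /= horner_algX.
by rewrite -rmorphXn.
Qed.

Lemma fixed_ind (Q : R -> Prop) :
    (forall c : k, Q c%:A) -> Q (base (h ^+ n)) -> Q (x ^+ m) -> Q (y ^+ m) ->
    (forall r s, Q r -> Q s -> Q (r + s)) ->
    (forall r s, Q r -> Q s -> Q (r * s)) ->
  forall r, eta r = r -> Q r.
Proof.
move=> QC Qh Qx Qy QD QM r /fixed_normal_form[p [J [pm /(_ J (leqnn J)) ->]]].
have Q0 : Q 0 by rewrite -(scale0r 1).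
have QX s t : Q s -> Q (s ^+ t).
  move=> Qs; elim: t => [|t IH]; first by rewrite expr0 -(scale1r 1).
  by rewrite exprS; apply: QM.
have QP p' : Q (base (P (p' \Po 'X^n))).
  rewrite base_Xn; elim/poly_ind: p' => [|p' c IH]; first by rewrite rmorph0.
  by rewrite rmorphD rmorphM /= horner_algX horner_algC; apply/QD/QC/QM.
have Qz l : (m %| `|l|)%N -> Q (zmon l).
  by case: l => t /= /dvdnP[t' ->]; rewrite mulnC exprM; apply: QX.
have Qmon l : Q (base (P (p l \Po 'X^n)) * zmon l).
  case: (pm l) => [->|ml]; first by rewrite comp_poly0 !rmorph0 mul0r.
  by apply: QM; [apply: QP | apply: Qz].
by rewrite /int_sum; elim/big_ind: _ => // i _; apply: QD.
Qed.

(** y^m x^m is fixed, so only powers of h^n occur in it. *)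
Lemma yx_poly_Xn : exists2 A, A != 0 & yx_poly m = A \Po 'X^n.
Proof.
have yx_fixed : yx_poly m \Po (gamma *: 'X) = yx_poly m.
  apply: (@base_of_poly_inj k b); apply: (@base_inj _ _ sigma (P a)).
  by rewrite -eta_P -yx_pow rmorphM /= eta_xm eta_ym.
have [|A AE] := @poly_of_Xn k (yx_poly m) n ord_gamma_gt0.
  move=> i i0; rewrite (prim_order_dvd ord_gamma); apply/eqP.
  have := congr1 (fun p : {poly k} => p`_i) yx_fixed.
  by rewrite coef_comp_scale -[RHS]mul1r => /(mulIf i0).
exists A => //; apply/eqP => A0; have := size_yx_poly m.
by rewrite AE A0 comp_poly0 size_poly0.
Qed.

Lemma qcommX (A : algType k) (u v : A) c s t : u * v = c *: (v * u) ->
  u ^+ s * v ^+ t = c ^+ (s * t) *: (v ^+ t * u ^+ s).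
Proof.
move=> uv; have uvt : u * v ^+ t = c ^+ t *: (v ^+ t * u).
  elim: t => [|t IH]; first by rewrite mulr1 mul1r scale1r.
  rewrite exprS mulrA uv -scalerAl -[v * u * _]mulrA IH -scalerAr scalerA.
  by rewrite -exprS mulrA.
elim: s => [|s IH]; first by rewrite mulr1 mul1r scale1r.
rewrite exprS -mulrA IH -scalerAr [u * (_ * _)]mulrA uvt -scalerAl scalerA.
by rewrite -mulrA -exprD mulSn addnC.
Qed.

Lemma xm_hn : x ^+ m * base (h ^+ n) = q ^+ (m * n) *: (base (h ^+ n) * x ^+ m).
Proof. by rewrite rmorphXn /= (qcommX _ _ x_h). Qed.

Lemma hn_ym : base (h ^+ n) * y ^+ m = q ^+ (m * n) *: (y ^+ m * base (h ^+ n)).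
Proof. by rewrite rmorphXn /= (qcommX _ _ h_y) mulnC. Qed.

(* If [q ^+ (m * n) = 1], the fixed ring is commutative while [R] is not.     *)
Lemma qmn_neq1 : q ^+ (m * n) != 1.
Proof.
apply/eqP => qmn; pose H := base (h ^+ n); pose C (r s : R) := r * s = s * r.
have CHx : C H (x ^+ m) by rewrite /C xm_hn qmn scale1r.
have CHy : C H (y ^+ m) by rewrite /C hn_ym qmn scale1r.
have C_sym r s : C r s -> C s r by rewrite /C => ->.
have CD t r s : C t r -> C t s -> C t (r + s) by rewrite /C mulrDl mulrDr => -> ->.
have CM t r s : C t r -> C t s -> C t (r * s).
  by rewrite /C => tr ts; rewrite mulrA tr -mulrA ts mulrA.
have CC t (c : k) : C t c%:A by rewrite /C mulr_algl mulr_algr.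
have Cyx_x : C (x ^+ m) (y ^+ m * x ^+ m).
  rewrite yx_pow; have [A _ ->] := yx_poly_Xn; rewrite base_Xn.
  elim/poly_ind: A => [|A c IH]; first by rewrite /C rmorph0 mulr0 mul0r.
  rewrite rmorphD rmorphM /= horner_algX horner_algC.
  by apply: CD (CC _ _); apply: CM IH (C_sym _ _ CHx).
(* x^m commutes with y^m x^m; cancel x^m on the right. *)
have Cxy : C (x ^+ m) (y ^+ m).
  have /(gwa_domain dom Pa_neq0)[] :
      (x ^+ m * y ^+ m - y ^+ m * x ^+ m) * x ^+ m = 0.
    by rewrite mulrBl -!mulrA Cyx_x -mulrA subrr.
    by move/eqP; rewrite subr_eq0 => /eqP.
  by move/(@zmon_neq0 (Posz m)).
have C_gen t : C t H -> C t (x ^+ m) -> C t (y ^+ m) ->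
    forall r, eta r = r -> C t r.
  by move=> tH tx ty; apply: fixed_ind => // r s; [apply: CD | apply: CM].
have [[CxH CyH] Cyx] := (C_sym _ _ CHx, C_sym _ _ CHy, C_sym _ _ Cxy).
have C_fixed s : eta s = s -> forall r, eta r = r -> C s r.
  by move=> es; apply: (C_gen); apply: (C_sym); apply: (C_gen _ _ _ _ _ es).
(* [theta] embeds [R] into the commutative fixed ring, contradicting x h = q h x. *)
have : x * base h = base h * x.
  apply: theta_inj; rewrite !rmorphM.
  exact: (C_fixed _ (theta_fixed _) _ (theta_fixed _)).
rewrite x_h => /eqP; rewrite -subr_eq0 -{2}[base h * x]scale1r -scalerBl.
rewrite scaler_eq0 subr_eq0 (negPf q_neq1) /= => /eqP.
case/(gwa_domain dom Pa_neq0); last exact: (@zmon_neq0 1).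
by rewrite -(rmorph0 base) => /base_inj/base_h_neq0.
Qed.

(** The argument of [at_h0_theta_h] for the inverse of [theta]: the preimages U, V, W of h^n, x^m,
    y^m generate [R] and q-commute with parameter q^(m n). *)
Lemma at_h0_theta_inv (psi : {rmorphism R -> K}) U z t :
    (forall c : k, psi c%:A = ratC c) -> theta U = base (h ^+ n) ->
    (0 < t)%N -> psi z = ratX ^+ t ->
  psi U = 0.
Proof.
move=> psiC UE t0 zX; apply: contrapT => U0.
have [V VE] := theta_surj eta_xm; have [W WE] := theta_surj eta_ym.
have [A A0 AE] := yx_poly_Xn.
have theta_U p : theta (horner_alg U p) = horner_alg (base (h ^+ n)) p.
  by rewrite lrmorph_horner_alg UE.
have [|||U_alg V0 W0] := @algebraic_of_qcomm psi psiC U V W A (q ^+ (m * n))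
    qmn_neq1 (expf_neq0 _ q_neq0) A0 _ _ _ U0.
- by apply: theta_inj; rewrite linearZ /= !rmorphM /= VE UE xm_hn.
- by apply: theta_inj; rewrite linearZ /= !rmorphM /= WE UE hn_ym.
- by apply: theta_inj; rewrite theta_U rmorphM /= WE VE yx_pow AE base_Xn.
(* Stated through the existence of a preimage, so that [fixed_ind] applies to theta(s). *)
have psi_alg s : exists r, theta r = theta s /\ alg (psi r).
  move: (theta s) (theta_fixed s); apply: fixed_ind.
  - move=> c; exists c%:A; rewrite psiC; split; last exact: rat_algebraicC.
    by rewrite linearZ /= rmorph1.
  - by exists U.
  - by exists V; rewrite V0; split; last exact: rat_algebraic0.
  - by exists W; rewrite W0; split; last exact: rat_algebraic0.
  - move=> _ _ [r [<- ra]] [r' [<- r'a]]; exists (r + r'); rewrite !rmorphD.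
    by split; last exact: rat_algebraicD.
  - move=> _ _ [r [<- ra]] [r' [<- r'a]]; exists (r * r'); rewrite !rmorphM.
    by split; last exact: rat_algebraicM.
have [r [/theta_inj ->]] := psi_alg z; rewrite zX.
exact: ratXn_transcendental.
Qed.

Lemma psiC_of (psi : {rmorphism R -> K}) :
  (forall p, psi (base (P p)) = ratC p.[0]) -> forall c : k, psi c%:A = ratC c.
Proof. by move=> psiP c; rewrite -base_C psiP hornerC. Qed.

(** Used with N = 1 for arbitrary elements and with N = n for fixed ones. *)
Lemma at_h0_factor (p : int -> {poly k}) J N r : (0 < N)%N ->
    r = int_sum J (fun l => base (P (p l \Po 'X^N)) * zmon l) ->
    psi1 r = 0 -> psi2 r = 0 ->
  exists r', r = base (h ^+ N) * r'.
Proof.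
move=> N0 rE; rewrite rE => /at_h0_kernel r1 /r1 {}r1.
exists (int_sum J (fun l => base (P ((p l %/ 'X) \Po 'X^N)) * zmon l)).
have factor (f : {poly k}) z : (f \Po 'X^N).[0] = 0 ->
    base (P (f \Po 'X^N)) * z = base (h ^+ N) * (base (P ((f %/ 'X) \Po 'X^N)) * z).
  rewrite horner_comp hornerXn expr0n (gtn_eqF N0) => f0.
  have {1}-> : f = (f %/ 'X) * 'X.
    by rewrite divpK // -['X]subr0 -polyC0 dvdp_XsubCl; apply/eqP.
  rewrite comp_polyM comp_polyX rmorphM /= rmorphM /= base_of_polyXn mulrA.
  by congr (_ * _); rewrite -!rmorphM mulrC.
rewrite /int_sum mulr_sumr; apply: eq_bigr => i _.
by case: (r1 i (ltn_ord i)) => /factor -> /factor ->; rewrite mulrDr.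
Qed.

(** U, the preimage of h^n, is h r, and theta(h) is h^n theta(t). Applying the inverse of [theta] to
    the latter gives h = U t = h r t, so r is a unit, hence a scalar. *)
Lemma theta_h_poly : exists c : k, c != 0 /\ theta (base h) = base (c *: h ^+ n).
Proof.
have psi1C := psiC_of psi1P; have psi2C := psiC_of psi2P.
have psi1_xm : psi1 (x ^+ m) = ratX ^+ m by rewrite rmorphXn /= psi1x.
have psi2_ym : psi2 (y ^+ m) = ratX ^+ m by rewrite rmorphXn /= psi2y.
have th1 := at_h0_theta_h psi1C eta_xm psi1_xm.
have th2 := at_h0_theta_h psi2C eta_ym psi2_ym.
have [U UE] := theta_surj eta_fixed_hn.
have U1 : psi1 U = 0 := at_h0_theta_inv (z := x) psi1C UE (ltn0Sn 0) psi1x.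
have U2 : psi2 U = 0 := at_h0_theta_inv (z := y) psi2C UE (ltn0Sn 0) psi2y.
have [r Ur] : exists r, U = base h * r.
  have [d [J Ud]] := gwa_normal_form U.
  have [s ds] := choice (fun l => base_of_poly_surj (d l)).
  rewrite -(expr1 h); apply: (@at_h0_factor s J 1) => //.
  rewrite {1}(Ud J (leqnn J)); apply: int_sum_eq => l.
  by rewrite expr1 comp_polyXr -ds.
have [t tE] : exists t, theta (base h) = base (h ^+ n) * theta t.
  have [s [J [_ /(_ J (leqnn J)) thE]]] := fixed_normal_form (theta_fixed (base h)).
  have [t tE] := at_h0_factor ord_gamma_gt0 thE th1 th2.
  (* Cancelling h^n shows that the cofactor is fixed, so it is in the image of [theta]. *)
  have [|t' t'E] := @theta_surj t; last by exists t'; rewrite t'E.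
  have : eta (base (h ^+ n) * t) = base (h ^+ n) * t by rewrite -tE theta_fixed.
  rewrite rmorphM /= eta_fixed_hn => et.
  have /(gwa_domain dom Pa_neq0)[] : base (h ^+ n) * (eta t - t) = 0.
  - by rewrite mulrBr et subrr.
  - by rewrite -(rmorph0 base) => /base_inj/base_h_exp_neq0.
  - by move/eqP; rewrite subr_eq0 => /eqP.
have hUt : base h = U * t by apply: theta_inj; rewrite rmorphM /= UE tE.
have rt : r * t = 1.
  have /(gwa_domain dom Pa_neq0)[] : base h * (r * t - 1) = 0.
    by rewrite mulrBr mulr1 mulrA -Ur -hUt subrr.
    by rewrite -(rmorph0 base) => /base_inj/base_h_neq0.
  by move/eqP; rewrite subr_eq0 => /eqP.
have [e [e' [re _ ee']]] := gwa_unit dom Pa_neq0 rt Pa_not_unit.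
have [c [s [s' [c0 + /(_ bP)[s0 s'0]]]]] := base_ring_unit ee'.
rewrite s0 s'0 mul1r => eC.
exists c^-1; split; first by rewrite invr_eq0.
rewrite base_scale -UE Ur re eC base_scale !rmorph1 -scalerAr mulr1 linearZ /=.
by rewrite scalerA mulVf // scale1r.
Qed.
End PolyCase.

(** * Equality of the orders, and the conclusion *)

Lemma orders_eq : q != 1 -> n = m.
Proof.
move=> q_neq1; have [bL|bP] : b = LaurentBase \/ b = PolyBase.
    by case: b; [right|left].
  have [d [c [c0 thE dE]]] := theta_h_laurent bL.
  by apply: (degree_count thE c0); case: dE; [left|right].
have [psi1 [psi2 [psi1P [psi1x psi1y] psi2P [psi2x psi2y]]]] := at_h0_exists bP.
have [c [c0 thE]] :=
  theta_h_poly bP q_neq1 psi1P psi1x psi1y psi2P psi2x psi2y.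
by apply: (degree_count thE c0); left.
Qed.
End Theta.

Lemma eta_trivial : gamma = 1 -> mu = 1 -> forall r, eta r = r.
Proof.
move=> g1 mu1; have eta_hN N : eta (base (h ^+ N)) = base (h ^+ N).
  by rewrite eta_hX g1 expr1n scale1r.
elim/gwa_ind=> [d| | |r s er es|r s er es].
- have [N [p [pE _]]] := base_ring_denominator d.
  have /(gwa_domain dom Pa_neq0)[] : base (h ^+ N) * (eta (base d) - base d) = 0.
  + rewrite mulrBr -{1}eta_hN -!rmorphM /= pE eta_P g1 scale1r comp_polyXr.
    exact: subrr.
  + by rewrite -(rmorph0 base) => /base_inj/base_h_exp_neq0.
  + by move/eqP; rewrite subr_eq0 => /eqP.
- by rewrite eta_x mu1 invr1 scale1r.
- by rewrite eta_y mu1 scale1r.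
- by rewrite rmorphD /= er es.
- by rewrite rmorphM /= er es.
Qed.
End Eta.
End QuantumGWA.

Lemma inverse_lrmorph (k : fieldType) (A B : algType k) (f : {lrmorphism A -> B}) :
  bijective f -> exists g : {lrmorphism B -> A}, cancel f g /\ cancel g f.
Proof.
case=> g fK gK.
pose g1 := GRing.isZmodMorphism.Build B A g (can2_zmod_morphism fK gK).
pose g2 := GRing.isMonoidMorphism.Build B A g (can2_monoid_morphism fK gK).
pose g3 := GRing.isScalable.Build k B A *:%R g (can2_scalable fK gK).
by exists (HB.pack g g1 g2 g3 : {lrmorphism B -> A}).
Qed.

Lemma fixed_val_comp (k : fieldType) (A B : algType k) (eta : algAut A)
    (g : {lrmorphism B -> fixed_alg eta}) :
  exists theta : {lrmorphism B -> A}, forall r, theta r = g r :> A.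
Proof.
pose t (r : B) : A := g r.
have tB : zmod_morphism t by move=> r s; rewrite /t rmorphB.
have tM : monoid_morphism t by split=> [|r s]; rewrite /t ?rmorph1 ?rmorphM.
have tZ : scalable t by move=> c r; rewrite /t linearZ.
pose g1 := GRing.isZmodMorphism.Build B A t tB.
pose g2 := GRing.isMonoidMorphism.Build B A t tM.
pose g3 := GRing.isScalable.Build k B A *:%R t tZ.
by exists (HB.pack t g1 g2 g3 : {lrmorphism B -> A}).
Qed.

Theorem proposition4p16
  (k : fieldType) (b : base_kind)
  (q : k) (q_neq0 : q != 0) (q_neq1 : q != 1)
  (sigma : algAut (base_ring k b))
  (sigma_h : sigma (base_h k b) = q *: base_h k b)
  (Na : nat) (Na_gt0 : (0 < Na)%N) (c : 'I_Na -> k)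
  (c_neq0 : b = LaurentBase -> forall i : 'I_Na, c i != 0)
  (a : {poly k}) (aE : a = \prod_(i < Na) ('X - (c i)%:P))
  (i0 : nat) (a_i0 : a`_i0 != 0)
  (gamma mu : k) (n m : nat)
  (ord_gamma : n.-primitive_root gamma)
  (ord_mu : m.-primitive_root mu)
  (gamma_Cg : in_Cg a gamma)
  (n_dvd_i0 : (n %| i0)%N)
  (coprime_nm : coprime n m)
  (eta : algAut (gwa sigma (base_of_poly b a)))
  (etaE : is_eta i0 gamma mu eta)
  (eta_neq1 : ~ (forall r : gwa sigma (base_of_poly b a), eta r = r)) :
  ~ alg_isomorphic (fixed_alg eta) (gwa sigma (base_of_poly b a)).

Proof.
case=> f /inverse_lrmorph[g [fK gK]].
have [eta_h eta_y eta_x] := etaE.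
(* As n | i0, [eta] acts on x by the inverse of mu alone. *)
have gi0 : gamma ^+ i0 = 1.
  by apply/eqP; rewrite -(prim_order_dvd ord_gamma).
rewrite gi0 mulr1 in eta_x.
have a_size : (1 < size a)%N.
  by rewrite aE -big_enum /= (size_prod_XsubC _ c) size_enum_ord ltnS.
have a0_neq0 : b = LaurentBase -> a.[0] != 0.
  move=> bL; rewrite aE horner_prod; apply/prodf_neq0 => i _.
  by rewrite hornerXsubC sub0r oppr_eq0 c_neq0.
(* [theta] is the inverse isomorphism followed by the inclusion of the fixed ring. *)
have [theta thetaE] := fixed_val_comp g.
have nm : n = m.
  apply: (orders_eq q_neq0 sigma_h a_size a0_neq0 ord_gamma ord_mu coprime_nm
    eta_h eta_y eta_x (theta := theta)) => //.
  - by move=> r s; rewrite !thetaE => /val_inj/(can_inj gK).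
  - by move=> r; rewrite thetaE; apply/eqP; apply: (valP (g r)).
  - move=> s /eqP es; exists (f (FixedAlg es)).
    by rewrite thetaE fK.
have n1 : n = 1.
  by move: coprime_nm; rewrite -nm /coprime gcdnn => /eqP.
apply: eta_neq1; apply: (eta_trivial a_size eta_h eta_y eta_x).
  by move/prim_expr_order: ord_gamma; rewrite n1 expr1.
by move/prim_expr_order: ord_mu; rewrite -nm n1 expr1.
Qed.
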